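(* Let $k$ be a field and let $G$ be a finite simple graph. Suppose that in each chordless even cycle in $G$ there is a vertex that has a whisker. Then $G$ is sequentially $S_2$ (over $k$).
   Context: A vertex $x$ of $G$ has a whisker if there is a vertex $z\in V(G)$ with $\deg z=1$ and $\{x,z\}$ an edge of $G$. A finitely generated graded module $M$ over a Noetherian graded $k$-algebra $R$ satisfies Serre's condition $S_r$ if $\operatorname{depth} M_{\mathfrak p}\ge \min(r,\dim M_{\mathfrak p})$ for all $\mathfrak p\in\operatorname{Spec}(R)$. A finitely generated $\mathbb Z$-graded $R$-module $M$ ($R$ a standard graded $k$-algebra) is sequentially $S_r$ if there is a finite filtration $0=M_0\subset M_1\subset\cdots\subset M_t=M$ by graded submodules such that each quotient $M_i/M_{i-1}$ satisfies $S_r$ and $\dim(M_1/M_0)<\dim(M_2/M_1)<\cdots<\dim(M_t/M_{t-1})$. A simplicial complex $\Delta$ on $[n]=\{1,\dots,n\}$ is sequentially $S_r$ over $k$ if its face ring $k[\Delta]=k[x_1,\dots,x_n]/I_\Delta$ is sequentially $S_r$ as a module over $R=k[x_1,\dots,x_n]$; here $I_\Delta$ is the Stanley-Reisner ideal, generated by the squarefree monomials $\prod_{j\in F}x_j$ with $F\notin\Delta$. For a finite simple graph $G$, $\Delta_G$ is the simplicial complex on the vertex set of $G$ whose faces are the independent sets of vertices of $G$; $G$ is called sequentially $S_r$ if $\Delta_G$ is. *)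

(* Defs.v *)
From HB Require Import structures.
From mathcomp Require Import all_boot all_order all_algebra ring_quotient.
From mathcomp Require Import generic_quotient mpoly.
From mathcomp Require Import boolp constructive_ereal.
From mathcomp Require Import ring.

Set Implicit Arguments.
Unset Strict Implicit.
Unset Printing Implicit Defensive.

Import Order.TTheory GRing.Theory Num.Theory.

Local Open Scope ring_scope.
Local Open Scope quotient_scope.

(* Supremum of a set of natural numbers, in {-oo} u Z u {+oo}; it is -oo on
   the empty set. *)
Definition sup_nat (P : nat -> Prop) : \bar int :=
  match pselect (exists m, P m /\ forall i, P i -> (i <= m)%N) with
  | left h => ((projT1 (cid h))%:Z)%:E%E
  | right _ => if `[< exists i, P i >] then +oo%E else -oo%E
  end.

Section SubModule.
Variables (R : comNzRingType) (M : lmodType R) (L : submodClosed M).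

Record submod := SubMod { submod_val :> M; submod_valP : submod_val \in L }.

HB.instance Definition _ : isSub M (GRing.SubmodClosed.sort L) submod := [isSub for submod_val].
HB.instance Definition _ := [Choice of submod by <:].
HB.instance Definition _ := [SubChoice_isSubLmodule of submod by <:].

(* The submodule N :&: L of M, viewed as a submodule of L. *)
Variable N : submodClosed M.
Definition submod_trace : {pred submod} := fun x => submod_val x \in N.

Lemma submod_trace_closed : subsemimod_closed submod_trace.
Proof.
have [[N0 ND] NZ] := GRing.subsemimodClosedP N.
by split=> [|a u]; [split=> [|u v]|]; rewrite !unfold_in; [|exact: ND|exact: NZ].
Qed.

HB.instance Definition _ :=
  GRing.isSubmodClosed.Build R submod submod_trace submod_trace_closed.
End SubModule.
Arguments submod_trace {R M} L N.

Section QuotientModule.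
Variables (R : comNzRingType) (M : lmodType R) (N : submodClosed M).

Definition submod_pred : {pred M} := fun x => x \in N.

Lemma submod_pred_zmod_closed : zmod_closed submod_pred.
Proof.
have [[N0 ND] NZ] := GRing.subsemimodClosedP N.
split=> [|x y Nx Ny]; rewrite unfold_in //.
by apply: ND => //; rewrite -scaleN1r; apply: NZ.
Qed.

HB.instance Definition _ :=
  GRing.isZmodClosed.Build M submod_pred submod_pred_zmod_closed.

Definition quotmod : Type := Quotient.quot submod_pred.
HB.instance Definition _ := GRing.Zmodule.on quotmod.

Definition quotmod_proj (x : M) : quotmod := \pi_(Quotient.quot submod_pred) x.

Lemma quotmod_projP x y : (quotmod_proj x = quotmod_proj y) <-> (x - y \in N).
Proof.
rewrite /quotmod_proj; split=> [/eqP|xy]; first by rewrite -Quotient.idealrBE.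
by apply/eqP; rewrite -Quotient.idealrBE.
Qed.

Lemma quotmod_projD x y :
  quotmod_proj (x + y) = quotmod_proj x + quotmod_proj y.
Proof. exact: (Quotient.pi_add submod_pred x y). Qed.

Lemma quotmod_projK (x : quotmod) :
  quotmod_proj (repr (x : Quotient.quot submod_pred)) = x.
Proof. exact: reprK. Qed.

Definition quotmod_scale (a : R) (x : quotmod) : quotmod :=
  quotmod_proj (a *: repr (x : Quotient.quot submod_pred)).

Lemma quotmod_projZ a x :
  quotmod_scale a (quotmod_proj x) = quotmod_proj (a *: x).
Proof.
apply/quotmod_projP; rewrite -scalerBr; apply: (GRing.subsemimodClosedP N).2.
by apply/quotmod_projP; rewrite quotmod_projK.
Qed.

Lemma quotmod_scaleA a b x :
  quotmod_scale a (quotmod_scale b x) = quotmod_scale (a * b) x.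
Proof. by rewrite -(quotmod_projK x) !quotmod_projZ scalerA. Qed.

Lemma quotmod_scale1 : left_id 1 quotmod_scale.
Proof. by move=> x; rewrite -(quotmod_projK x) quotmod_projZ scale1r. Qed.

Lemma quotmod_scaleDr : right_distributive quotmod_scale +%R.
Proof.
move=> a x y; rewrite -(quotmod_projK x) -(quotmod_projK y).
by rewrite -quotmod_projD !quotmod_projZ scalerDr quotmod_projD.
Qed.

Lemma quotmod_scaleDl x : {morph quotmod_scale^~ x : a b / a + b}.
Proof.
by move=> a b; rewrite -(quotmod_projK x) !quotmod_projZ scalerDl quotmod_projD.
Qed.

HB.instance Definition _ := GRing.Zmodule_isLmodule.Build R quotmod
  quotmod_scaleA quotmod_scale1 quotmod_scaleDr quotmod_scaleDl.
End QuotientModule.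

Definition subquot (R : comNzRingType) (M : lmodType R)
  (L N : submodClosed M) : lmodType R := quotmod (submod_trace L N).

Section Localization.
Variables (R : comNzRingType) (p : prime_idealr R).

Record loc_den := LocDen { den_val : R; den_valP : den_val \notin p }.
HB.instance Definition _ := [isSub for den_val].
HB.instance Definition _ := [Choice of loc_den by <:].
Implicit Types s t u : loc_den.
Local Notation "# s" := (den_val s) (at level 2, format "# s").

Fact den1_subproof : 1 \notin p. Proof. by rewrite idealr1. Qed.
Definition den1 := LocDen den1_subproof.

Fact denM_subproof s t : #s * #t \notin p.
Proof. by rewrite prime_idealrM negb_or !den_valP. Qed.
Definition denM s t := LocDen (denM_subproof s t).

Section Carrier.
Variable M : lmodType R.
Implicit Types (m n : M).

Definition loc_rel (x y : M * loc_den) : bool :=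
  `[< exists u, #u *: (#(y.2) *: x.1) = #u *: (#(x.2) *: y.1) >].

Lemma loc_rel_equiv : equiv_class_of loc_rel.
Proof.
have sym x y : loc_rel x y -> loc_rel y x.
  by move=> /asboolP[u e]; apply/asboolP; exists u.
split=> [x|x y|y x z]; first by apply/asboolP; exists den1.
  by apply/idP/idP; apply: sym.
move=> /asboolP[u e1] /asboolP[v e2]; apply/asboolP.
exists (denM (denM u v) y.2) => /=.
move: e1 e2; rewrite !scalerA => e1 e2.
have -> : #u * #v * #(y.2) * #(z.2) = #v * #(z.2) * (#u * #(y.2)) by ring.
have -> : #u * #v * #(y.2) * #(x.2) = #u * #(x.2) * (#v * #(y.2)) by ring.
rewrite -[LHS]scalerA e1 -[RHS]scalerA -e2 !scalerA.
by congr (_ *: _); ring.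
Qed.

Canonical loc_equiv_rel := EquivRelPack loc_rel_equiv.
Canonical loc_encModRel := defaultEncModRel loc_rel.

Definition localization : Type := {eq_quot loc_rel}.
HB.instance Definition _ := Choice.on localization.
Implicit Types x y z : localization.

Definition frac m s : localization := \pi_({eq_quot loc_rel}) (m, s).

Lemma frac_eqP m s n t :
  frac m s = frac n t <->
  exists u, #u *: (#t *: m) = #u *: (#s *: n).
Proof.
split=> [/eqmodP /asboolP //|h].
by apply/eqmodP; apply/asboolP.
Qed.

Definition numer x : M := (repr (x : {eq_quot loc_rel})).1.
Definition denom x : loc_den := (repr (x : {eq_quot loc_rel})).2.

Lemma fracK x : frac (numer x) (denom x) = x.
Proof. by rewrite /frac /numer /denom -surjective_pairing reprK. Qed.

Lemma fracP x : exists m s, x = frac m s.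
Proof. by exists (numer x), (denom x); rewrite fracK. Qed.

Lemma frac_rep m s :
  exists u, #u *: (#s *: numer (frac m s))
          = #u *: (#(denom (frac m s)) *: m).
Proof. exact/frac_eqP/fracK. Qed.

Definition loc_add x y :=
  frac (#(denom y) *: numer x + #(denom x) *: numer y)
       (denM (denom x) (denom y)).
Definition loc_opp x := frac (- numer x) (denom x).

Lemma loc_addE m s n t :
  loc_add (frac m s) (frac n t)
  = frac (#t *: m + #s *: n) (denM s t).
Proof.
have [u eu] := frac_rep m s; have [v ev] := frac_rep n t.
rewrite /loc_add; move: (numer (frac m s)) (denom (frac m s)) eu => m' s' eu.
move: (numer (frac n t)) (denom (frac n t)) ev => n' t' ev.
apply/frac_eqP; exists (denM u v) => /=.
move: eu ev; rewrite !scalerDr !scalerA => eu ev; congr (_ + _).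
  have -> : #u * #v * (#s * #t) * #t' = #v * #t * #t' * (#u * #s) by ring.
  have -> : #u * #v * (#s' * #t') * #t = #v * #t * #t' * (#u * #s') by ring.
  by rewrite -scalerA eu scalerA.
have -> : #u * #v * (#s * #t) * #s' = #u * #s * #s' * (#v * #t) by ring.
have -> : #u * #v * (#s' * #t') * #s = #u * #s * #s' * (#v * #t') by ring.
by rewrite -scalerA ev scalerA.
Qed.

Lemma loc_oppE m s : loc_opp (frac m s) = frac (- m) s.
Proof.
have [u eu] := frac_rep m s; apply/frac_eqP; exists u.
by rewrite !scalerN eu.
Qed.

Lemma frac_eq m s n t :
  #t *: m = #s *: n -> frac m s = frac n t.
Proof. by move=> e; apply/frac_eqP; exists den1; rewrite e. Qed.

Lemma loc_addA : associative loc_add.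
Proof.
move=> x y z; rewrite -(fracK x) -(fracK y) -(fracK z) !loc_addE.
apply: frac_eq; rewrite /= !scalerDr !scalerA addrA.
by congr (_ *: _ + _ *: _ + _ *: _); ring.
Qed.

Lemma loc_addC : commutative loc_add.
Proof.
move=> x y; rewrite -(fracK x) -(fracK y) !loc_addE.
apply: frac_eq; rewrite /= !scalerDr !scalerA addrC.
by congr (_ *: _ + _ *: _); ring.
Qed.

Lemma loc_add0 : left_id (frac 0 den1) loc_add.
Proof.
move=> x; rewrite -(fracK x) !loc_addE; apply: frac_eq.
by rewrite /= scaler0 add0r scale1r mul1r.
Qed.

Lemma loc_addN : left_inverse (frac 0 den1) loc_opp loc_add.
Proof.
move=> x; rewrite -(fracK x) loc_oppE loc_addE; apply: frac_eq.
by rewrite /= scalerN addNr !scaler0.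
Qed.

HB.instance Definition _ := GRing.isZmodule.Build localization
  loc_addA loc_addC loc_add0 loc_addN.

Lemma addfE m s n t :
  frac m s + frac n t = frac (#t *: m + #s *: n) (denM s t).
Proof. exact: loc_addE. Qed.

End Carrier.

(* (a / s) . (m / t) = (a m) / (s t); with M = R this is the multiplication of
   the local ring R_p. *)
Definition loc_scale (M : lmodType R) (a : localization R^o)
    (x : localization M) : localization M :=
  frac ((numer a : R) *: numer x) (denM (denom a) (denom x)).

Lemma loc_scaleE (M : lmodType R) (a : R^o) s (m : M) t :
  loc_scale (frac a s) (frac m t) = frac ((a : R) *: m) (denM s t).
Proof.
have [u eu] := frac_rep a s; have [v ev] := frac_rep m t.
rewrite /loc_scale; move: (numer (frac a s)) (denom (frac a s)) eu => a' s' eu.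
move: (numer (frac m t)) (denom (frac m t)) ev => m' t' ev.
apply/frac_eqP; exists (denM u v) => /=.
have {}eu : #u * (#s * a') = #u * (#s' * a) by exact: eu.
move: ev; rewrite !scalerA => ev.
have -> : #u * #v * (#s * #t) * a' = #u * (#s * a') * (#v * #t) by ring.
by rewrite eu -scalerA ev scalerA; congr (_ *: _); ring.
Qed.

Section ScaleTheory.
Variable M : lmodType R.
Local Notation scl := (@loc_scale M).

Lemma loc_scaleA (a b : localization R^o) x :
  scl a (scl b x) = scl (loc_scale a b) x.
Proof.
have [[a' [s ->]] [b' [t ->]] [m [u ->]]] :=
  And3 (fracP a) (fracP b) (fracP x).
rewrite (loc_scaleE b') (loc_scaleE a' s b') 2!loc_scaleE; apply: frac_eq => /=.
rewrite !scalerA; congr (_ *: _).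
rewrite -[a' *: b']/((a' : R) * b'); ring.
Qed.

Lemma loc_scale1 : left_id (frac (1 : R^o) den1) scl.
Proof.
move=> x; rewrite -(fracK x) !loc_scaleE; apply: frac_eq.
by rewrite /= scale1r mul1r.
Qed.

Lemma loc_scaleDr : right_distributive scl +%R.
Proof.
move=> a x y; rewrite -(fracK a) -(fracK x) -(fracK y) addfE !loc_scaleE addfE.
apply: frac_eq; rewrite /= !scalerDr !scalerA.
by congr (_ *: _ + _ *: _); ring.
Qed.

Lemma loc_scaleDl x : {morph scl^~ x : a b / a + b}.
Proof.
move=> a b /=; rewrite -(fracK a) -(fracK b) -(fracK x) addfE !loc_scaleE addfE.
apply: frac_eq; rewrite /= !scalerDr !scalerA -scalerDl /GRing.scale /=.
by congr (_ *: _); ring.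
Qed.
End ScaleTheory.

(* R_p is carried by the localization of the regular module R^o. *)
Definition loc_ring : Type := localization R^o.
HB.instance Definition _ := GRing.Zmodule.on loc_ring.

Definition loc_mul : loc_ring -> loc_ring -> loc_ring := @loc_scale R^o.
Definition loc_one : loc_ring := frac (1 : R^o) den1.

Lemma loc_mulA : associative loc_mul.
Proof. exact: loc_scaleA. Qed.

Lemma loc_mulC : commutative loc_mul.
Proof.
move=> a b; rewrite /loc_mul -(fracK a) -(fracK b) !loc_scaleE; apply: frac_eq.
by rewrite /= /GRing.scale /=; ring.
Qed.

Lemma loc_mul1 : left_id loc_one loc_mul.
Proof. exact: loc_scale1. Qed.

Lemma loc_mulDl : left_distributive loc_mul +%R.
Proof. by move=> a b c; exact: (loc_scaleDl c a b). Qed.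

Lemma loc_one_neq0 : loc_one != 0.
Proof.
apply/eqP => /frac_eqP[u]; rewrite /= scaler0 scaler0 /GRing.scale /= mul1r mulr1.
by move=> u0; have := den_valP u; rewrite u0 idealr0.
Qed.

HB.instance Definition _ := GRing.Zmodule_isComNzRing.Build loc_ring
  loc_mulA loc_mulC loc_mul1 loc_mulDl loc_one_neq0.

Section LocModule.
Variable M : lmodType R.

Definition loc_mod : Type := localization M.
HB.instance Definition _ := GRing.Zmodule.on loc_mod.

Fact loc_mod_scaleA (a b : loc_ring) (x : loc_mod) :
  loc_scale a (loc_scale b x) = loc_scale (a * b) x.
Proof. exact: loc_scaleA. Qed.

HB.instance Definition _ := GRing.Zmodule_isLmodule.Build loc_ring loc_mod
  loc_mod_scaleA (@loc_scale1 M) (@loc_scaleDr M) (@loc_scaleDl M).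
End LocModule.
End Localization.

Section Invariants.
Variables (A : comNzRingType) (M : lmodType A).

(* A chain P_0 < P_1 < ... < P_d of prime ideals containing Ann(M). *)
Definition prime_chain (d : nat) : Prop :=
  exists P : nat -> prime_idealr A,
    [/\ forall i a, (i <= d)%N -> (forall x : M, a *: x = 0) -> a \in P i,
        forall i, (i < d)%N -> {subset P i <= P i.+1}
      & forall i, (i < d)%N -> exists2 a, a \in P i.+1 & a \notin P i].

(* Krull dimension of A / Ann(M); it is -oo for the zero module. *)
Definition krull_dim : \bar int := sup_nat prime_chain.

(* x \in (a_1, ..., a_r) M *)
Definition in_span (s : seq A) (x : M) : Prop :=
  exists y : nat -> M, x = \sum_(i < size s) nth 0 s i *: y i.

Definition regular_seq (s : seq A) : Prop :=
  (forall i x, (i < size s)%N ->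
     in_span (take i s) (nth 0 s i *: x) -> in_span (take i s) x)
  /\ exists x, ~ in_span s x.

Definition nonunit (a : A) : Prop := ~ exists b, b * a = 1.

(* Intended for A local, whose maximal ideal is then the set of nonunits.  For
   M = 0 no sequence is regular and the value is -oo; the usual convention is
   depth 0 = +oo, but the dimension of 0 is -oo, so both conventions give the
   same Serre conditions below. *)
Definition depth : \bar int :=
  sup_nat (fun d => exists s : seq A,
    [/\ size s = d, forall a, a \in s -> nonunit a & regular_seq s]).
End Invariants.

Definition serre (R : comNzRingType) (r : nat) (M : lmodType R) : Prop :=
  forall p : prime_idealr R,
    (Order.min (r%:Z)%:E (krull_dim (loc_mod p M)) <= depth (loc_mod p M))%E.

(* N is the sum of its intersections with the homogeneous components of M,
   gr d being the component of degree d. *)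
Definition graded_submod (R : comNzRingType) (M : lmodType R)
    (gr : int -> M -> Prop) (N : submodClosed M) : Prop :=
  forall x, x \in N -> exists s : seq M,
    (forall y, y \in s -> y \in N /\ exists d, gr d y) /\ x = \sum_(y <- s) y.

Definition seq_serre (R : comNzRingType) (r : nat) (M : lmodType R)
    (gr : int -> M -> Prop) : Prop :=
  exists (t : nat) (F : nat -> submodClosed M),
    [/\ (forall x, (x \in F 0%N) = (x == 0)) /\ (forall x, x \in F t),
        forall i, (i <= t)%N -> graded_submod gr (F i),
        forall i, (i < t)%N -> {subset F i <= F i.+1} /\
                               (exists2 x, x \in F i.+1 & x \notin F i),
        forall i, (i < t)%N -> serre r (subquot (F i.+1) (F i))
      & forall i, (i.+1 < t)%N ->
          (krull_dim (subquot (F i.+1) (F i))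
             < krull_dim (subquot (F i.+2) (F i.+1)))%E].

Section FaceRing.
Variables (k : fieldType) (T : finType) (Delta : {set {set T}}).

(* k[x_v | v in T], the variable x_v being 'X_(enum_rank v). *)
Local Notation S := {mpoly k[#|T|]}.

Definition face_monomial (F : {set T}) : S := \prod_(v in F) 'X_(enum_rank v).

Definition SR_ideal : {pred S^o} := fun f =>
  `[< exists g : {set T} -> S,
        f = \sum_(F : {set T} | F \notin Delta) g F * face_monomial F >].

Lemma SR_ideal_closed : subsemimod_closed SR_ideal.
Proof.
split=> [|a f]; first split=> [|f g]; rewrite !unfold_in.
- by apply/asboolP; exists (fun=> 0); rewrite big1 // => F _; rewrite mul0r.
- move=> /asboolP[f' ->] /asboolP[g' ->]; apply/asboolP.
  exists (fun F => f' F + g' F); rewrite -big_split /=.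
  by apply: eq_bigr => F _; rewrite mulrDl.
- move=> /asboolP[f' ->]; apply/asboolP; exists (fun F => a * f' F).
  by rewrite /GRing.scale /= mulr_sumr; apply: eq_bigr => F _; rewrite mulrA.
Qed.

HB.instance Definition _ :=
  GRing.isSubmodClosed.Build S S^o SR_ideal SR_ideal_closed.

Definition face_ring : lmodType S := quotmod SR_ideal.

Definition face_ring_piece (d : int) (x : face_ring) : Prop :=
  match d with
  | Posz e => exists2 f : S, f \is e.-homog & x = quotmod_proj SR_ideal f
  | Negz _ => x = 0
  end.

Definition complex_seq_serre (r : nat) : Prop :=
  seq_serre r face_ring_piece.
End FaceRing.

Section Graphs.
Variables (T : finType) (e : rel T).

Definition simple_graph : Prop := ssrbool.symmetric e /\ ssrbool.irreflexive e.

Definition deg (z : T) : nat := #|[set w | e z w]|.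

Definition has_whisker (x : T) : Prop := exists z, deg z = 1%N /\ e x z.

(* c lists the vertices of a cycle, of length at least 3, in cyclic order. *)
Definition graph_cycle (c : seq T) : Prop := (2 < size c)%N /\ ucycle e c.

Definition chordless (c : seq T) : Prop :=
  forall x y, x \in c -> y \in c -> e x y -> y = next c x \/ x = next c y.

Definition independence_complex : {set {set T}} :=
  [set F : {set T} | [forall x in F, forall y in F, ~~ e x y]].

Definition graph_seq_serre (k : fieldType) (r : nat) : Prop :=
  complex_seq_serre k independence_complex r.
End Graphs.

(* Main.v *)
From HB Require Import structures.
Require Import Defs.
From mathcomp Require Import all_boot all_order all_algebra ring_quotient.
From mathcomp Require Import generic_quotient mpoly.
From mathcomp Require Import boolp constructive_ereal.
From mathcomp Require Import ring.

(** The proof has a combinatorial half and an algebraic half, joined by the notion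
of an exchange connected complex: two faces A and B of the same size are joined by
faces of that size, all containing A :&: B, each obtained from the one before by
exchanging a single vertex.

Combinatorics ([independence_complex_exchange_connected]).  Two independent sets A
and B of the same size span a bipartite graph on the vertices they do not share.
If it has a vertex of degree at most one, that vertex can be exchanged into the
other set.  Otherwise it contains a cycle, hence a chordless one, which is even; by
hypothesis a vertex x of it carries a leaf z.  As x is the only neighbour of z, the
leaf can be exchanged for x in the set containing x, and for anything in the other
one.  In each case A and B come to share one more vertex.

Algebra ([exchange_connected_seq_serre]).  Let r(G) be the size of a largest face
containing G.  The face ring is filtered by the spans of the monomials whose
support G has r(G) < b, where b runs through the facet sizes.  The quotient N at j
has as a basis the monomials with r(G) = j; it embeds in the direct sum of the
polynomial rings k[F] over the facets F of size j, and its annihilator is the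
intersection of the corresponding coordinate primes.  So N has dimension j
([layer_krull_dim]), where the upper bound amounts to the algebraic dependence of
j + 1 polynomials in j variables, proved by counting monomials.

It remains to see that N satisfies S_2 ([layer_serre]).  Let p be a prime of the
support and U the set of variables not in p, which are units locally.  All facets F
of size j that matter contain U, and #|F :\: U| = c is the same for all.

If c > 0, one takes the elementary symmetric polynomial a of degree c in the
variables outside U, which is a monomial on each F, and a polynomial b in p that
vanishes on no wall, that is, on no coordinate subspace of a set G of size j - 1
containing U.  For c > 1 the sum of the variables outside U will do; for c = 1 one
uses a polynomial in the variables of U, which exists unless p is too small for
depth two to be required.  Then a, b is regular on N: if b * y = a * y', then a
divides y on each F separately, and the quotients on two facets agree on a common
wall because b can be cancelled there.  Exchange connectedness propagates this
agreement to all facets through a given support, so that the quotients form an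
element of N ([locally_regular2]).

If c = 0, N is locally a polynomial ring, and what is needed is that a prime of
height at least two in a polynomial ring contains a regular sequence of length two.
This follows from a trichotomy that passes from A to A[x]: the localization at a
prime is a field, or a discrete valuation ring, or has depth at least two
([prime_trichotomy_poly]). *)

Set Implicit Arguments.
Unset Strict Implicit.
Unset Printing Implicit Defensive.

Import Order.TTheory GRing.Theory Num.Theory.

(** * Exchange sequences of faces *)

(** One step replaces at most one element of X, and keeps C. *)
Definition exchange (T : finType) (Delta : {set {set T}}) (C : {set T}) :
    rel {set T} := fun X Y =>
  [&& X \in Delta, Y \in Delta, C \subset X, C \subset Y, #|X| == #|Y|
    & #|X| <= #|X :&: Y|.+1].

(** Strong connectivity of all pure skeleta of all links of Delta at once: the
link is that of A :&: B, whose faces are kept throughout. *)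
Definition exchange_connected (T : finType) (Delta : {set {set T}}) : Prop :=
  forall A B : {set T}, A \in Delta -> B \in Delta -> #|A| = #|B| ->
  connect (exchange Delta (A :&: B)) A B.

Section ExchangeRel.
Variables (T : finType) (Delta : {set {set T}}).
Implicit Types A B C X Y : {set T}.

Lemma exchange_sym C : ssrbool.symmetric (exchange Delta C).
Proof.
move=> X Y; rewrite /exchange setIC [#|X| == _]eq_sym.
case: eqP => [->|_]; last by rewrite !andbF.
by case: (X \in _) (Y \in _) (C \subset X) (C \subset Y) => [] [] [] [].
Qed.

Lemma connect_exchange_sub C C' X Y : C \subset C' ->
  connect (exchange Delta C') X Y -> connect (exchange Delta C) X Y.
Proof.
move=> sCC'; apply: connect_sub => {}X {}Y /and5P[XD YD sX sY h].
by apply: connect1; apply/and5P; split=> //; apply: subset_trans sCC' _.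
Qed.

(** Both ends of the sequence may move.  Each round enlarges A :&: B, and later
rounds keep the larger intersection, hence also the original one. *)
Lemma exchange_connected_closer :
  (forall A B, A \in Delta -> B \in Delta -> #|A| = #|B| -> A != B ->
     exists A' B', [/\ connect (exchange Delta (A :&: B)) A A',
        connect (exchange Delta (A :&: B)) B B', A' \in Delta /\ B' \in Delta,
        #|A'| = #|A| /\ #|B'| = #|B| & A :&: B \proper A' :&: B']) ->
  exchange_connected Delta.
Proof.
move=> H A B; have [n] := ubnP (#|A| - #|A :&: B|).
elim: n A B => // n IHn A B lt_n AD BD cAB.
have [<-|neqAB] := eqVneq A B; first exact: connect0.
have [A' [B' [AA' BB' [A'D B'D] [cA' cB'] lt_I]]] := H A B AD BD cAB neqAB.
apply: connect_trans AA' _; rewrite (sym_connect_sym (@exchange_sym _)).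
apply: connect_trans BB' _; rewrite (sym_connect_sym (@exchange_sym _)).
apply: (connect_exchange_sub (proper_sub lt_I)); apply: IHn => //.
  have := proper_card lt_I; have := subset_leq_card (subsetIl A' B').
  move: lt_n; rewrite cA' ltnS => h1 h2 h3.
  apply: leq_trans h1; rewrite ltn_sub2l //; exact: leq_trans h3 h2.
by rewrite cA' cB'.
Qed.
End ExchangeRel.

Lemma connect_invariant (T : finType) (r : rel T) (P : T -> Prop) x y :
  (forall u v, r u v -> P u -> P v) -> connect r x y -> P x -> P y.
Proof.
move=> rP /connectP[p]; elim: p x => [|z p IHp] x /=; first by move=> _ ->.
by case/andP=> rxz pz yl Px; apply: (IHp z) => //; apply: rP Px.
Qed.

(** * Chordless cycles in graphs *)

Section Cycles.
Variables (T : finType) (e : rel T).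
Hypotheses (e_sym : ssrbool.symmetric e) (e_irr : ssrbool.irreflexive e).

(** A path that cannot be prolonged at its head closes up, since a neighbour of
the head other than the next vertex already lies on the path. *)
Lemma cycle_of_min_degree2 (X : {set T}) x :
  x \in X ->
  (forall x z, x \in X -> exists2 y, y \in X & e x y && (y != z)) ->
  exists2 c, graph_cycle e c & {subset c <= X}.
Proof.
move=> xX deg2.
suff H n p y : #|T| - size p < n -> path e y p -> uniq (y :: p) ->
    {subset y :: p <= X} -> exists2 c, graph_cycle e c & {subset c <= X}.
  by apply: (H _ [::] x (ltnSn _)) => // z; rewrite inE => /eqP->.
elim: n p y => // n IHn p y lt_n py Uyp sX.
have [z zX /andP[eyz zp]] := deg2 y (head y p) (sX y (mem_head _ _)).
have zy : z != y by apply: contraTneq eyz => ->; rewrite e_irr.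
have [zIp|zNp] := boolP (z \in y :: p); last first.
  apply: (IHn (y :: p) z) => /=; last first.
  - by move=> w; rewrite inE => /predU1P[->//|]; apply: sX.
  - by rewrite zNp.
  - by rewrite e_sym eyz.
  - have : size (y :: p) <= #|T| by rewrite -(card_uniqP Uyp) max_card.
    by move=> /= h; move: lt_n; rewrite ltnS; apply: leq_trans; rewrite ltn_sub2l.
move: zIp; rewrite inE (negPf zy) /= => zIp.
case/splitPr: zIp py Uyp sX zp => p1 p2 py Uyp sX zp.
exists (y :: rcons p1 z).
  split.
    rewrite /= size_rcons !ltnS lt0n size_eq0; apply: contraNneq zp => ->.
    by rewrite /= eqxx.
  apply/andP; split.
    rewrite /= rcons_path last_rcons e_sym eyz andbT rcons_path.
    by move: py; rewrite cat_path /= => /and3P[-> ->].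
  move: Uyp; rewrite -cat_rcons /= cat_uniq mem_cat negb_or.
  by case/and3P=> /andP[-> _] ->.
by move=> w; rewrite -cats1 inE mem_cat => h; apply: sX; move: h;
   rewrite !inE mem_cat inE => /or3P[->|->|/eqP->]; rewrite ?eqxx ?orbT.
Qed.

(** A chord cuts off a shorter cycle, so a shortest one has no chord. *)
Lemma chordless_cycle_within (X : {set T}) c :
  graph_cycle e c -> {subset c <= X} ->
  exists c', [/\ graph_cycle e c', chordless e c' & {subset c' <= X}].
Proof.
have [n] := ubnP (size c); elim: n c => // n IHn c; rewrite ltnS => le_n cc cX.
have [ch|nch] := pselect (chordless e c); first by exists c.
have [x [y [xc yc exy yx xy]]] : exists x y,
    [/\ x \in c, y \in c, e x y, y <> next c x & x <> next c y].
  apply: contrapT => H; apply: nch => x y xc yc exy.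
  apply: contrapT => /not_orP[h1 h2]; apply: H.
  by exists x, y.
have [s2 /andP[cyc Uc]] := cc.
have yNx : y != x by apply: contraTneq exy => ->; rewrite e_irr.
case: (rot_to xc) => i q rc.
have yq : y \in q by move: yc; rewrite -(mem_rot i) rc inE (negPf yNx).
move: cyc Uc; rewrite -(rot_cycle i) -(rot_uniq i) rc => cyc Uq.
have Uc : uniq c by rewrite -(rot_uniq i) rc.
move: yx xy; rewrite -!(next_rot i Uc) rc.
have szc : size c = (size q).+1 by rewrite -(size_rot i) rc.
case/splitPr: yq cyc Uq rc szc => q1 q2 cyc Uq rc szc yx xy.
have q1n : q1 != [::].
  by apply/eqP=> q10; apply: yx; rewrite q10 /= eqxx.
have q2n : q2 != [::].
  apply/eqP=> q20; apply: xy; move: Uq; rewrite q20 cats1 => Uq.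
  rewrite next_nth inE (negPf yNx) mem_rcons mem_head /=.
  rewrite eq_sym (negPf yNx).
  have -> : index y (rcons q1 y) = size q1.
    rewrite -cats1 index_cat /= eqxx addn0.
    case: ifP => // yq1; move: Uq => /= /andP[_].
    by rewrite rcons_uniq yq1.
  by rewrite nth_default // size_rcons.
apply: (IHn (x :: rcons q1 y)).
- apply: leq_trans le_n; rewrite szc /= size_rcons size_cat /=.
  by rewrite ltnS addnS ltnS -[X in X < _]addn0 ltn_add2l lt0n size_eq0.
- split; first by rewrite /= size_rcons !ltnS lt0n size_eq0.
  apply/andP; split.
    rewrite /= rcons_path last_rcons e_sym exy andbT.
    by move: cyc; rewrite /= rcons_path cat_path /= rcons_path
       => /andP[/and3P[-> ->]].
  move: Uq; rewrite -cat_rcons /= cat_uniq mem_cat negb_or.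
  by case/and3P=> /andP[-> _] ->.
move=> w wi; apply: cX; rewrite -(mem_rot i) rc -cat_rcons.
by move: wi; rewrite !inE mem_cat => /orP[->|->]; rewrite ?orbT.
Qed.

Lemma bipartite_path_parity (A X : {set T}) x p :
  {in X &, forall u v, e u v -> (v \in A) = ~~ (u \in A)} ->
  {subset x :: p <= X} -> path e x p ->
  (last x p \in A) = (x \in A) (+) odd (size p).
Proof.
move=> bip; elim: p x => [|y p IHp] x sX /=; first by rewrite addbF.
case/andP=> exy py; rewrite IHp //; last first.
  by move=> w wi; apply: sX; rewrite inE wi orbT.
rewrite (bip x y) //; first by case: (x \in A) (odd _) => [] [].
  by apply: sX; rewrite mem_head.
by apply: sX; rewrite !inE eqxx orbT.
Qed.

Lemma even_bipartite_cycle (A X : {set T}) c :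
  {in X &, forall u v, e u v -> (v \in A) = ~~ (u \in A)} ->
  {subset c <= X} -> graph_cycle e c -> ~~ odd (size c).
Proof.
move=> bip; case: c => [|x p] sX [// _ /andP[cyc _]].
have := @bipartite_path_parity A X x (rcons p x) bip _ cyc.
rewrite last_rcons size_rcons /= => H.
have {}H : (x \in A) = (x \in A) (+) ~~ odd (size p).
  by apply: H => w; rewrite inE mem_rcons => /orP[/eqP->|]; apply: sX;
     rewrite mem_head.
by move: H; case: (x \in A) (odd _) => [] [].
Qed.
End Cycles.

(** * Whiskers make the independence complex exchange connected *)

Section Whiskers.
Variables (T : finType) (e : rel T).
Hypothesis e_simple : simple_graph e.
Local Notation Delta := (independence_complex e).
Implicit Types A B X : {set T}.

Lemma independentP X :
  reflect {in X &, forall x y, ~~ e x y} (X \in Delta).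
Proof.
rewrite inE; apply: (iffP forall_inP) => H x.
  by move=> y xX yX; move/forall_inP: (H x xX); apply.
by move=> xX; apply/forall_inP => y yX; apply: H.
Qed.

Lemma independent_exchange A a b : A \in Delta -> a \in A -> b \notin A ->
    {in A, forall x, e b x -> x = a} ->
  b |: A :\ a \in Delta.
Proof.
have [esym eirr] := e_simple.
move=> /independentP AD aA bA h; apply/independentP => x y.
rewrite !inE => /predU1P[->|/andP[xa xA]] /predU1P[->|/andP[ya yA]].
- by rewrite eirr.
- by apply: contra ya => eby; rewrite (h y).
- by rewrite esym; apply: contra xa => ebx; rewrite (h x).
- exact: AD.
Qed.

Lemma exchange_step A a b (C : {set T}) : A \in Delta -> a \in A -> b \notin A ->
    {in A, forall x, e b x -> x = a} -> C \subset A -> a \notin C ->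
  exchange Delta C A (b |: A :\ a) /\ #|b |: A :\ a| = #|A|.
Proof.
move=> AD aA bA h CA aC.
have c : #|b |: A :\ a| = #|A|.
  by rewrite cardsU1 !inE (negPf bA) andbF (cardsD1 a A) aA.
split=> //; apply/and5P; split=> //.
- exact: independent_exchange.
- apply/subsetP => x xC; rewrite !inE (subsetP CA) // andbT orbC.
  by case: eqP => // xa; rewrite -xa xC in aC.
rewrite c eqxx /= (cardsD1 a A) aA ltnS subset_leq_card //.
by apply/subsetP => x; rewrite !inE => /andP[-> ->]; rewrite orbT.
Qed.

(** All neighbours of b in A lie outside B because B is independent; so b can
replace its only neighbour in A, or anything if it has none. *)
Lemma closer_low_degree A B b z : A \in Delta -> B \in Delta ->
    #|A| = #|B| -> b \in B :\: A ->
    {in A :\: B, forall y, e b y -> y = z} ->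
  exists2 a, a \in A & exchange Delta (A :&: B) A (b |: A :\ a)
    /\ #|b |: A :\ a| = #|A|
    /\ A :&: B \proper (b |: A :\ a) :&: B.
Proof.
move=> AD BD cAB bBA hz; move: (bBA); rewrite inE => /andP[bA bB].
have [a aAB ha] : exists2 a, a \in A :\: B & {in A, forall y, e b y -> y = a}.
  have hI y : y \in A -> e b y -> y \in A :\: B.
    move=> yA; apply: contraTT; rewrite inE yA andbT negbK => yB.
    by move/independentP: BD; apply.
  have [zAB|zNAB] := boolP (z \in A :\: B).
    by exists z => // y yA eby; apply: hz => //; apply: hI.
  have [/eqP|[a aAB]] := set_0Vmem (A :\: B).
    rewrite setD_eq0 => sAB; have /eqP AB : A == B by rewrite eqEcard sAB cAB /=.
    by rewrite AB bB in bA.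
  exists a => // y yA eby; have yAB := hI _ yA eby.
  by rewrite -(hz y yAB eby) yAB in zNAB.
move: (aAB); rewrite inE => /andP[aB aA].
have aI : a \notin A :&: B by rewrite inE (negPf aB) andbF.
have [ex c] := exchange_step AD aA bA ha (subsetIl A B) aI.
exists a => //; split=> //; split=> //; apply/properP; split.
  apply/subsetP => x; rewrite !inE => /andP[xA xB]; rewrite xA xB !andbT.
  by rewrite orbC; case: eqP => // xa; rewrite -xa xB in aB.
by exists b; rewrite !inE ?eqxx ?bB // (negPf bA).
Qed.

(** A leaf z attached to a vertex x of A only enters A in place of x, and enters
B in place of anything. *)
Lemma closer_whisker A B x z : A \in Delta -> B \in Delta -> #|A| = #|B| ->
    x \in A :\: B -> z \notin (A :\: B) :|: (B :\: A) ->
    (forall w, e z w -> w = x) -> z \notin A ->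
  exists b, [/\ exchange Delta (A :&: B) A (z |: A :\ x),
    exchange Delta (A :&: B) B (z |: B :\ b),
    #|z |: A :\ x| = #|A| /\ #|z |: B :\ b| = #|B|
    & A :&: B \proper (z |: A :\ x) :&: (z |: B :\ b)].
Proof.
move=> AD BD cAB; rewrite inE => /andP[xB xA]; rewrite !inE.
move=> zX zx zA; have zB : z \notin B by move: zX; rewrite (negPf zA) /= andbF.
have [b] : exists b, b \in B :\: A.
  apply/set0Pn; rewrite setD_eq0; apply: contraNN xB => sBA.
  have /eqP -> // : B == A by rewrite eqEcard sBA cAB /=.
rewrite inE => /andP[bA bB]; exists b.
have [|||exA cA] := @exchange_step A x z (A :&: B) AD xA zA.
- by move=> w _; apply: zx.
- exact: subsetIl.
- by rewrite inE (negPf xB) andbF.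
have [|||exB cB] := @exchange_step B b z (A :&: B) BD bB zB.
- by move=> w wB /zx wx; rewrite -wx wB in xB.
- exact: subsetIr.
- by rewrite inE (negPf bA).
split=> //; apply/properP; split; last first.
  by exists z; rewrite !inE ?eqxx // (negPf zA).
apply/subsetP => w; rewrite !inE => /andP[wA wB]; rewrite wA wB !andbT.
have -> : w != x by apply: contraNneq xB => <-.
have -> : w != b by apply: contraNneq bA => <-.
by rewrite orbT.
Qed.

(** Two independent sets A and B of the same size span a bipartite graph X
outside A :&: B.  Either it has a vertex of degree at most one, which can be
exchanged, or it contains a chordless cycle; that cycle is even, and a leaf z
hanging from one of its vertices can be swapped into both A and B. *)
Lemma independence_complex_exchange_connected :
  (forall c : seq T, graph_cycle e c -> chordless e c ->
     ~~ odd (size c) -> exists2 x, x \in c & has_whisker e x) ->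
  exchange_connected Delta.
Proof.
have [esym eirr] := e_simple.
move=> Hcyc; apply: exchange_connected_closer => A B AD BD cAB neqAB.
pose X := (A :\: B) :|: (B :\: A).
have [deg2|ndeg2] := pselect
  (forall x z, x \in X -> exists2 y, y \in X & e x y && (y != z)); last first.
  have [x [z [xX hz]]] :
      exists x z, x \in X /\ {in X, forall y, e x y -> y = z}.
    apply: contrapT => H; apply: ndeg2 => x z xX.
    apply: contrapT => H'; apply: H; exists x, z; split=> // y yX exy.
    by apply/eqP; apply: contrapT => /negP yz; apply: H'; exists y; rewrite ?exy.
  move: (xX); rewrite inE => /orP[xAB|xBA].
    have [|a aB [ex [c p]]] := @closer_low_degree B A x z BD AD (Logic.eq_sym cAB) xAB.
      by move=> y yBA; apply: hz; rewrite inE yBA orbT.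
    exists A, (x |: B :\ a); split=> //.
    - by rewrite setIC connect1.
    - by case/and3P: ex.
    - by rewrite setIC [A :&: _]setIC.
  have [|a aA [ex [c p]]] := @closer_low_degree A B x z AD BD cAB xBA.
    by move=> y yAB; apply: hz; rewrite inE yAB.
  exists (x |: A :\ a), B; split=> //; first exact: connect1.
  by case/and3P: ex.
have bip : {in X &, forall u v, e u v -> (v \in A) = ~~ (u \in A)}.
  move=> u v; rewrite !inE => uX vX euv.
  have [uA|uA] := boolP (u \in A); have [vA|vA] := boolP (v \in A) => //.
    by move/independentP: AD => /(_ u v uA vA); rewrite euv.
  move: uX vX; rewrite (negPf uA) (negPf vA) !andbF /= => uB vB.
  by move/independentP: BD => /(_ u v uB vB); rewrite euv.
have [x0 x0X] : exists x, x \in X.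
  apply/set0Pn; apply: contra neqAB; rewrite setU_eq0 !setD_eq0.
  by rewrite eqEsubset.
have [c cyc cX] := cycle_of_min_degree2 esym eirr x0X deg2.
have [{cyc cX}c [cyc ch cX]] := chordless_cycle_within esym eirr cyc cX.
have [x xc [z [dz exz]]] := Hcyc c cyc ch (even_bipartite_cycle bip cX cyc).
have xX := cX x xc.
have zx w : e z w -> w = x.
  move=> ezw; apply/eqP; apply: contraT => wx.
  suff : 1 < deg e z by rewrite dz.
  rewrite /deg (cardsD1 x) (cardsD1 w) !inE wx ezw esym exz.
  by [].
have zX : z \notin X.
  apply/negP => zX; have [y yX /andP[ezy /eqP]] := deg2 z x zX.
  by move/zx: ezy.
have nexz Y : Y \in Delta -> x \in Y -> z \notin Y.
  by move=> /independentP YD xY; apply: contraL exz => zY; apply: YD.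
move: (xX); rewrite inE => /orP[xAB|xBA].
  have [|b [exA exB [cA cB] p]] := closer_whisker AD BD cAB xAB zX zx.
    by move: xAB; rewrite inE => /andP[_ xA]; apply: nexz AD xA.
  exists (z |: A :\ x), (z |: B :\ b); split=> //; try exact: connect1.
  by case/and3P: exA => _ -> _; case/and3P: exB => _ -> _.
have [||b [exB exA [cB cA] p]] := closer_whisker BD AD (Logic.eq_sym cAB) xBA _ zx.
- by rewrite setUC.
- by move: xBA; rewrite inE => /andP[_ xB]; apply: nexz BD xB.
exists (z |: A :\ b), (z |: B :\ x); split=> //; rewrite ?[A :&: B]setIC.
- exact: connect1.
- exact: connect1.
- by case/and3P: exA => _ -> _; case/and3P: exB => _ -> _.
- by rewrite [_ :&: (z |: B :\ x)]setIC.
Qed.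
End Whiskers.

Lemma subset_interpolate (T : finType) (G F : {set T}) b :
  G \subset F -> (#|G| <= b <= #|F|)%N ->
  exists H : {set T}, [/\ G \subset H, H \subset F & #|H| = b].
Proof.
move=> sGF /andP[le_Gb]; elim: b le_Gb => [|b IHb] le_Gb le_bF.
  by exists G; split=> //; apply/eqP; rewrite -leqn0.
move: le_Gb; rewrite leq_eqVlt => /predU1P[<-|]; first by exists G.
rewrite ltnS => /IHb[|H [sGH sHF cH]]; first exact: ltnW.
have [v] : exists v, v \in F :\: H.
  apply/set0Pn; rewrite setD_eq0; apply: contraTN le_bF => /subset_leq_card.
  by rewrite cH -ltnNge ltnS.
rewrite inE => /andP[vH vF]; exists (v |: H); split.
- exact: subset_trans sGH (subsetUr _ _).
- by rewrite subUset sub1set vF.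
- by rewrite cardsU1 vH cH.
Qed.

Local Open Scope ring_scope.
Local Notation frac := Defs.frac.

(** * Suprema of sets of natural numbers *)

Lemma sup_nat_ge (P : nat -> Prop) d : P d -> (d%:Z%:E <= sup_nat P)%E.
Proof.
move=> Pd; rewrite /sup_nat; case: pselect => [h|_].
  by case: (cid h) => m [Pm le_m] /=; rewrite lee_fin lez_nat le_m.
by case: asboolP => [_|[]]; [rewrite leey | exists d].
Qed.

Lemma sup_nat_eq (P : nat -> Prop) d :
  P d -> (forall i, P i -> (i <= d)%N) -> sup_nat P = d%:Z%:E.
Proof.
move=> Pd le_d; apply/eqP; rewrite eq_le sup_nat_ge // andbT.
rewrite /sup_nat; case: pselect => [h|[]]; last by exists d.
by case: (cid h) => m [Pm _] /=; rewrite lee_fin lez_nat le_d.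
Qed.

Lemma min_sup_nat_le (P : nat -> Prop) r (s : \bar int) :
  (forall d i, (d <= r)%N -> (d <= i)%N -> P i -> (d%:Z%:E <= s)%E) ->
  (Order.min r%:Z%:E (sup_nat P) <= s)%E.
Proof.
move=> H; rewrite /sup_nat; case: pselect => [h|nh].
  case: (cid h) => m [Pm _] /=; rewrite ge_min.
  have [le_rm|lt_mr] := leqP r m; first by rewrite (H r m).
  by rewrite (H m m) ?orbT // ltnW.
case: asboolP => [[i0 Pi0]|_]; last by rewrite ge_min leNye orbT.
rewrite ge_min; apply/orP; left.
have [[i [le_ri Pi]]|nP] := pselect (exists i, (r <= i)%N /\ P i).
  exact: (H r i).
case: nh; have bP i : P i -> (i <= r)%N.
  by move=> Pi; rewrite leqNgt; apply/negP => lt_ri; apply: nP; exists i; rewrite ltnW.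
have ex : exists i, `[< P i >] by exists i0; apply/asboolP.
have ub i : `[< P i >] -> (i <= r)%N by move/asboolP; apply: bP.
have [m /asboolP Pm le_m] := ex_maxnP ex ub.
by exists m; split=> // i Pi; apply: le_m; apply/asboolP.
Qed.

(** * Prime ideals and localization *)

Section ComapPrime.
Variables (A B : comNzRingType) (f : {rmorphism A -> B}).
Variable P : prime_idealr B.

Definition comap : A -> bool := fun a => f a \in P.

Lemma comap_idealr_closed : idealr_closed comap.
Proof.
have E a : (a \in comap) = (f a \in P) by [].
split=> [||a u v]; rewrite !E.
- by rewrite rmorph0 rpred0.
- by rewrite rmorph1 idealr1.
move=> uP vP; by rewrite rmorphD rmorphM rpredD // idealMr.
Qed.

Lemma comap_prime_closed : prime_idealr_closed comap.
Proof.
have E a : (a \in comap) = (f a \in P) by [].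
by move=> u v; rewrite !E rmorphM prime_idealrM.
Qed.

HB.instance Definition _ := isIdealr.Build A comap comap_idealr_closed.
HB.instance Definition _ :=
  isPrimeIdealrClosed.Build A comap comap_prime_closed.

Lemma mem_comap a : (a \in comap) = (f a \in P).
Proof. by []. Qed.
End ComapPrime.

Section KernelPrime.
Variables (A : comNzRingType) (B : idomainType) (f : {rmorphism A -> B}).

Definition rker : A -> bool := fun a => f a == 0.

Lemma rker_idealr_closed : idealr_closed rker.
Proof.
have E a : (a \in rker) = (f a == 0) by [].
split=> [||a u v]; rewrite !E.
- by rewrite rmorph0.
- by rewrite rmorph1 oner_eq0.
move=> /eqP u0 /eqP v0.
by rewrite rmorphD rmorphM u0 v0 mulr0 addr0.
Qed.

Lemma rker_prime_closed : prime_idealr_closed rker.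
Proof.
have E a : (a \in rker) = (f a == 0) by [].
by move=> u v; rewrite !E rmorphM mulf_eq0.
Qed.

HB.instance Definition _ := isIdealr.Build A rker rker_idealr_closed.
HB.instance Definition _ := isPrimeIdealrClosed.Build A rker rker_prime_closed.

End KernelPrime.

Section PrimeTheory.
Variables (R : comNzRingType) (p : prime_idealr R).

Lemma prime_prod (I : Type) (r : seq I) (P : pred I) (F : I -> R) :
  (forall i, P i -> F i \notin p) -> \prod_(i <- r | P i) F i \notin p.
Proof.
move=> H; elim/big_ind: _ => //; first by rewrite idealr1.
by move=> a b ap bp; rewrite prime_idealrM negb_or ap.
Qed.

Lemma primeX a n : a \notin p -> a ^+ n \notin p.
Proof.
move=> ap; elim: n => [|n IHn]; first by rewrite expr0 idealr1.
by rewrite exprS prime_idealrM negb_or ap.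
Qed.
End PrimeTheory.

Section InSpan.
Variables (A : comNzRingType) (M : lmodType A).
Implicit Types (s : seq A) (x : M).

Lemma in_span_nil x : in_span [::] x <-> x = 0.
Proof.
split=> [[y ->]|->]; first by rewrite big_ord0.
by exists (fun=> 0); rewrite big_ord0.
Qed.

Lemma in_span_cons a s x :
  in_span (a :: s) x <-> exists y, in_span s (x - a *: y).
Proof.
split=> [[y ->]|[y0 [y e]]].
  exists (y 0%N), (fun i => y i.+1).
  by rewrite big_ord_recl /= addrAC subrr add0r.
exists (fun i => if i is i'.+1 then y i' else y0).
by rewrite big_ord_recl /= -e addrC subrK.
Qed.

Lemma in_spanZ s a x : in_span s x -> in_span s (a *: x).
Proof.
case=> y ->; exists (fun i => a *: y i); rewrite scaler_sumr.
by apply: eq_bigr => i _; rewrite !scalerA mulrC.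
Qed.

Lemma in_span1 a x : in_span [:: a] x <-> exists y, x = a *: y.
Proof.
rewrite in_span_cons; split=> [[y /in_span_nil/eqP]|[y ->]].
  by rewrite subr_eq0 => /eqP; exists y.
by exists y; apply/in_span_nil; rewrite subrr.
Qed.
End InSpan.

Section Localize.
Variables (R : comNzRingType) (p : prime_idealr R).

Definition to_loc (a : R) : loc_ring p := frac (a : R^o) (den1 p).

Lemma fracM (M : lmodType R) (a : R) s (x : M) t :
  (frac (a : R^o) s : loc_ring p) *: (frac x t : loc_mod p M) = frac (a *: x) (denM s t).
Proof. exact: loc_scaleE. Qed.

Lemma frac_mul (a b : R) s t :
  (frac (a : R^o) s : loc_ring p) * (frac (b : R^o) t : loc_ring p)
  = frac (a * b : R^o) (denM s t).
Proof. exact: loc_scaleE. Qed.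

Lemma to_loc_is_zmod_morphism : zmod_morphism to_loc.
Proof.
move=> a b; rewrite /to_loc; apply/esym.
have -> : - (frac (b : R^o) (den1 p) : loc_ring p) = frac (- b : R^o) (den1 p).
  exact: loc_oppE.
rewrite /loc_ring addfE; apply: frac_eq.
by rewrite /= !scale1r mulr1 scale1r.
Qed.

Lemma to_loc_is_monoid_morphism : monoid_morphism to_loc.
Proof.
split=> // a b; rewrite /to_loc frac_mul; apply: frac_eq.
by rewrite /= !scale1r mulr1 scale1r.
Qed.

HB.instance Definition _ :=
  GRing.isZmodMorphism.Build R (loc_ring p) to_loc to_loc_is_zmod_morphism.
HB.instance Definition _ :=
  GRing.isMonoidMorphism.Build R (loc_ring p) to_loc to_loc_is_monoid_morphism.

Lemma to_loc_unit (u : loc_den p) : exists v, v * to_loc (den_val u) = 1.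
Proof.
exists (frac (1 : R^o) u); rewrite /to_loc frac_mul.
rewrite -[RHS]/(frac (1 : R^o) (den1 p)).
by apply: frac_eq; rewrite /= /GRing.scale /= !(mulr1, mul1r).
Qed.

Lemma frac_to_loc (a : R) s :
  to_loc (den_val s) * (frac (a : R^o) s : loc_ring p) = to_loc a.
Proof.
rewrite /to_loc frac_mul; apply: frac_eq.
by rewrite /= mul1r scale1r.
Qed.

Lemma to_loc_nonunit a : a \in p -> nonunit (to_loc a).
Proof.
move=> ap [b]; have [b0 [s ->]] := fracP b.
rewrite /to_loc frac_mul -[RHS]/(frac (1 : R^o) (den1 p)) => /frac_eqP[u].
rewrite /= scale1r mulr1 => e.
have : den_val u * (den_val s * 1) \in p.
  have -> : den_val u * (den_val s * 1) = den_val u * (b0 * a) by [].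
  by rewrite !idealMr.
by rewrite mulr1 prime_idealrM (negPf (den_valP u)) (negPf (den_valP s)).
Qed.

Lemma den_not_in (P : prime_idealr (loc_ring p)) (u : R) :
  u \notin p -> to_loc u \notin P.
Proof.
move=> up; have [v e] := to_loc_unit (LocDen up).
by apply/negP => /(idealMr v); rewrite e idealr1.
Qed.

Variable M : lmodType R.
Implicit Types (s : seq R) (x y : M).

Lemma in_span_loc s x (t : loc_den p) :
  in_span (map to_loc s) (frac x t : loc_mod p M) <->
  exists u : loc_den p, in_span s (den_val u *: x).
Proof.
elim: s x t => [|a s IHs] x t /=.
  split=> [/in_span_nil/frac_eqP[u e]|[u /in_span_nil e]].
    by exists u; apply/in_span_nil; move: e; rewrite /= scale1r !scaler0.
  by apply/in_span_nil/frac_eqP; exists u; rewrite /= scale1r e !scaler0.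
have dE y w : (frac x t : loc_mod p M) - to_loc a *: (frac y w : loc_mod p M)
    = frac (den_val w *: x - (den_val t * a) *: y) (denM t w).
  rewrite /to_loc fracM.
  have -> : - (frac (a *: y) (denM (den1 p) w) : loc_mod p M)
     = frac (- (a *: y)) (denM (den1 p) w) by exact: loc_oppE.
  rewrite /loc_mod addfE; apply: frac_eq.
  rewrite /= !mul1r !scalerN !scalerA; congr (_ *: (_ - _ *: _)).
split.
  case/in_span_cons => y; have [y0 [w ->]] := fracP y.
  rewrite dE => /IHs[u h]; exists (denM u w); apply/in_span_cons.
  exists ((den_val u * den_val t) *: y0).
  by move: h; rewrite scalerBr !scalerA /= [a * _]mulrC mulrA.
case=> u /in_span_cons[y h]; apply/in_span_cons.
exists (frac y (denM u t)); rewrite dE; apply/IHs; exists (den1 p).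
rewrite scale1r; have := in_spanZ (den_val t) h.
by rewrite scalerBr !scalerA /= [den_val t * den_val u]mulrC.
Qed.

(** Regularity of s on the localization at p, with denominators cleared. *)
Definition locally_regular s : Prop :=
  (forall i x, (i < size s)%N -> in_span (take i s) (nth 0 s i *: x) ->
     exists2 u, u \notin p & in_span (take i s) (u *: x))
  /\ exists x, forall u, u \notin p -> ~ in_span s (u *: x).

Lemma depth_loc_ge s : {subset s <= p} -> locally_regular s ->
  ((size s)%:Z%:E <= depth (loc_mod p M))%E.
Proof.
move=> sp [reg [x0 hx0]]; apply: sup_nat_ge; exists (map to_loc s).
split; first by rewrite size_map.
  by move=> a /mapP[b bs ->]; apply: to_loc_nonunit; apply: sp.
split.
  move=> i x; rewrite size_map => lt_i; have [x' [t ->]] := fracP x.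
  rewrite -map_take (nth_map 0) // {1}/to_loc fracM => /in_span_loc[u].
  rewrite -/(GRing.scale _ _) scalerA mulrC -scalerA => /(reg _ _ lt_i)[v vp].
  rewrite scalerA => h; apply/in_span_loc.
  by exists (denM (LocDen vp) u).
exists (frac x0 (den1 p)) => /in_span_loc[u]; apply: hx0; exact: den_valP.
Qed.

Lemma prime_chain_loc d : prime_chain (loc_mod p M) d ->
  exists Q : nat -> prime_idealr R,
    [/\ forall i a, (i <= d)%N -> (forall x : M, a *: x = 0) -> a \in Q i,
        forall i, (i < d)%N -> {subset Q i <= Q i.+1},
        forall i, (i < d)%N -> exists2 a, a \in Q i.+1 & a \notin Q i
      & forall i, {subset Q i <= p}].
Proof.
case=> P [annP subP ltP]; exists (fun i => comap to_loc (P i)); split.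
- move=> i a le_i ann_a; apply: annP => // x.
  have [y [t ->]] := fracP x; rewrite /to_loc fracM ann_a.
  by apply: frac_eq; rewrite !scaler0.
- by move=> i lt_i a; apply: subP.
- move=> i lt_i; have [a aP aNP] := ltP i lt_i.
  have [a0 [s ea]] := fracP a; exists a0; rewrite mem_comap /= -(frac_to_loc a0 s).
    by rewrite idealMr // -ea.
  by rewrite prime_idealrM negb_or den_not_in ?den_valP -?ea.
move=> i a; apply: contraTT => /(den_not_in (P i)).
by rewrite mem_comap.
Qed.
End Localize.

Lemma prime_chain_le (A : comNzRingType) (M : lmodType A) d d' :
  (d' <= d)%N -> prime_chain M d -> prime_chain M d'.
Proof.
move=> le_d [P [h1 h2 h3]]; exists P; split=> [i a le_i|i lt_i|i lt_i].
- exact/h1/(leq_trans le_i).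
- exact/h2/(leq_trans lt_i).
- exact/h3/(leq_trans lt_i).
Qed.

(** A chain in the support of the localized module contracts to the chain Q in R.
Only chains of length at most r matter, and for each of them a sequence that is
at least as long suffices; neither the depth nor the local dimension need be
known. *)
Lemma serre_criterion (R : comNzRingType) (M : lmodType R) r :
  (forall (p : prime_idealr R) d (Q : nat -> prime_idealr R), (d <= r)%N ->
     (forall i a, (i <= d)%N -> (forall x : M, a *: x = 0) -> a \in Q i) ->
     (forall i, (i < d)%N -> {subset Q i <= Q i.+1}) ->
     (forall i, (i < d)%N -> exists2 a, a \in Q i.+1 & a \notin Q i) ->
     (forall i, {subset Q i <= p}) ->
     exists s : seq R,
       [/\ (d <= size s)%N, {subset s <= p} & locally_regular p M s]) ->
  serre r M.
Proof.
move=> H p; apply: min_sup_nat_le => d i le_dr le_di chi.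
have [Q [h1 h2 h3 h4]] := prime_chain_loc (prime_chain_le le_di chi).
have [s [le_ds sp reg]] := H p d Q le_dr h1 h2 h3 h4.
apply: le_trans (depth_loc_ge sp reg).
by rewrite lee_fin lez_nat.
Qed.

(** * Supports of monomials and coordinate primes *)

Section Support.
Variables (k : fieldType) (T : finType).
Local Notation S := {mpoly k[#|T|]}.
Local Notation mon := 'X_{1..#|T|}.
Implicit Types (m : mon) (f g : S) (F G H : {set T}) (v : T).

Definition var (v : T) : S := 'X_(enum_rank v).

Definition supp (m : mon) : {set T} := [set v | m (enum_rank v) != 0%N].

Definition set_mnm (F : {set T}) : mon :=
  [multinom nat_of_bool (enum_val i \in F) | i < #|T|].

Lemma suppD m1 m2 : supp (m1 + m2)%MM = supp m1 :|: supp m2.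
Proof. by apply/setP => v; rewrite !inE mnmDE addn_eq0 negb_and. Qed.

Lemma supp_set_mnm F : supp (set_mnm F) = F.
Proof. by apply/setP => v; rewrite inE mnmE enum_rankK eqb0 negbK. Qed.

Lemma set_mnm_le F m : F \subset supp m -> (set_mnm F <= m)%MM.
Proof.
move=> sFm; apply/mnm_lepP => i; rewrite mnmE.
have [iF|//] := boolP (enum_val i \in F).
by have := subsetP sFm _ iF; rewrite inE enum_valK lt0n.
Qed.

Lemma face_monomialE F : face_monomial k F = 'X_[set_mnm F].
Proof.
rewrite /face_monomial mprodXE; congr 'X_[_].
apply/mnmP => i; rewrite mnm_sumE mnmE.
have [iF|iNF] := boolP (enum_val i \in F).
  rewrite (bigD1 (enum_val i)) //= mnm1E enum_valK eqxx big1 // => v /andP[_ vi].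
  by rewrite mnm1E -(inj_eq enum_val_inj) enum_rankK (negPf vi).
rewrite big1 // => v vF; rewrite mnm1E -(inj_eq enum_val_inj) enum_rankK.
by case: eqP => // vi; rewrite -vi vF in iNF.
Qed.

Lemma face_monomial1 v : face_monomial k [set v] = var v.
Proof. by rewrite /face_monomial big_set1. Qed.

Lemma face_monomial_neq0 F : face_monomial k F != 0.
Proof. by rewrite face_monomialE -msize_poly_eq0 msizeX. Qed.

Lemma msupp_mul f g m : m \in msupp (f * g) ->
  exists m1 m2, [/\ m1 \in msupp f, m2 \in msupp g & m = (m1 + m2)%MM].
Proof. by move/msuppM_le => /allpairsP[[m1 m2] /= [h1 h2 ->]]; exists m1, m2. Qed.

Definition part (P : pred {set T}) f : S :=
  \sum_(m <- msupp f | P (supp m)) f@_m *: 'X_[m].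

Lemma mcoeff_part P f m : (part P f)@_m = if P (supp m) then f@_m else 0.
Proof.
rewrite /part raddf_sum /=.
under eq_bigr do rewrite mcoeffZ mcoeffX.
have [mf|mNf] := boolP (m \in msupp f); last first.
  rewrite (memN_msupp_eq0 mNf) if_same big_seq_cond big1 // => m' /andP[m'f _].
  by case: eqP => [e|]; rewrite ?mulr0 // -e m'f in mNf *.
rewrite big_mkcond (bigD1_seq m) //= big1 ?addr0 => [|m' m'm]; last first.
  by rewrite (negPf m'm) mulr0 if_same.
by rewrite eqxx mulr1.
Qed.

Lemma part_is_zmod_morphism P : zmod_morphism (part P).
Proof.
move=> f g; apply/mpolyP => m; rewrite mcoeffB !mcoeff_part mcoeffB.
by case: ifP; rewrite ?subr0.
Qed.

HB.instance Definition _ P :=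
  GRing.isZmodMorphism.Build S S (part P) (part_is_zmod_morphism P).

Lemma part_idP P f : part P f = f <-> (forall m, m \in msupp f -> P (supp m)).
Proof.
split=> [e m|H].
  by rewrite mcoeff_msupp -{1}e mcoeff_part; case: (P _); rewrite ?eqxx.
apply/mpolyP => m; rewrite mcoeff_part.
by case: ifP => // nP; rewrite memN_msupp_eq0 //; apply: contraFN nP; apply: H.
Qed.

Lemma part_eq0P P f :
  part P f = 0 <-> (forall m, m \in msupp f -> ~~ P (supp m)).
Proof.
split=> [e m|H].
  apply: contraTN => Pm; rewrite -mcoeff_eq0.
  by have := mcoeff_part P f m; rewrite Pm e mcoeff0 => <-.
apply/mpolyP => m; rewrite mcoeff_part mcoeff0.
by case: ifP => // Pm; rewrite memN_msupp_eq0 //; apply: contraTN Pm; apply: H.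
Qed.

Lemma part_part P f : part P (part P f) = part P f.
Proof. by apply/mpolyP => m; rewrite !mcoeff_part; case: (P _). Qed.

(** Setting the variables outside F to zero. *)
Definition kap (F : {set T}) : S -> S :=
  mmap (@mpolyC _ _) (fun i => if enum_val i \in F then 'X_i else 0).

HB.instance Definition _ F := GRing.RMorphism.on (kap F).

Lemma kapX F m : kap F 'X_[m] = if supp m \subset F then 'X_[m] else 0.
Proof.
rewrite /kap mmapX /mmap1; case: ifP => [sF|/negbT/subsetPn[v]].
  rewrite mpolyXE_id; apply: eq_bigr => i _; case: ifP => // /negbT iF.
  have : enum_val i \notin supp m by apply: contra iF; apply: (subsetP sF).
  by rewrite inE enum_valK negbK => /eqP->; rewrite !expr0.
rewrite inE => vm vF; rewrite (bigD1 (enum_rank v)) //= enum_rankK (negPf vF).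
by rewrite expr0n (negPf vm) mul0r.
Qed.

Lemma mcoeff_kap F f m : (kap F f)@_m = if supp m \subset F then f@_m else 0.
Proof.
elim/mpolyind: f => [|c m' f _ _ IHf]; first by rewrite rmorph0 mcoeff0 if_same.
rewrite rmorphD !mcoeffD IHf; set X := (kap F _)@_m.
suff -> : X = if supp m \subset F then (c *: 'X_[m'] : S)@_m else 0.
  by case: ifP; rewrite ?addr0.
rewrite {}/X -mul_mpolyC rmorphM /= kapX /kap mmapC !mul_mpolyC.
case: ifP => sm'; rewrite !(mcoeffZ, mcoeff0, mcoeffX).
  by case: eqP => [<-|_]; rewrite ?sm' // mulr0 if_same.
rewrite mulr0; case: eqP => [<-|_]; first by rewrite sm'.
by rewrite mulr0 if_same.
Qed.

Lemma kap_idP F f : kap F f = f <-> (forall m, m \in msupp f -> supp m \subset F).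
Proof.
split=> [e m|H].
  by rewrite mcoeff_msupp -{1}e mcoeff_kap; case: ifP; rewrite ?eqxx.
apply/mpolyP => m; rewrite mcoeff_kap.
by case: ifP => // nP; rewrite memN_msupp_eq0 //; apply: contraFN nP; apply: H.
Qed.

Lemma kap_kap F G f : kap F (kap G f) = kap (F :&: G) f.
Proof.
by apply/mpolyP => m; rewrite !mcoeff_kap subsetI; case: ifP => //=; case: ifP.
Qed.

Lemma kap_kapS F G f : F \subset G -> kap F (kap G f) = kap F f.
Proof. by move=> sFG; rewrite kap_kap (setIidPl sFG). Qed.

Lemma kap_face F H :
  kap F (face_monomial k H) = if H \subset F then face_monomial k H else 0.
Proof. by rewrite face_monomialE kapX supp_set_mnm. Qed.

Lemma kap_var F v : kap F (var v) = if v \in F then var v else 0.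
Proof. by rewrite -face_monomial1 kap_face sub1set. Qed.

Lemma kapXU F (i : 'I_#|T|) :
  kap F 'X_i = if enum_val i \in F then 'X_i else 0.
Proof. by have := kap_var F (enum_val i); rewrite /var enum_valK. Qed.

Lemma face_monomial_dvd H f :
  (forall m, m \in msupp f -> H \subset supp m) ->
  exists g, f = face_monomial k H * g.
Proof.
move=> sH; exists (\sum_(m <- msupp f) f@_m *: 'X_[m - set_mnm H]).
rewrite mulr_sumr [LHS]mpolyE; apply: eq_big_seq => m mf.
rewrite -scalerAr face_monomialE -mpolyXD addmC submK //.
exact/set_mnm_le/sH.
Qed.

(** A polynomial is divisible by x_i when it vanishes at x_i = 0. *)
Lemma face_monomial_dvd_kap H F f : kap F f = f ->
  (forall i, i \in H -> kap (F :\ i) f = 0) ->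
  exists2 g, f = face_monomial k H * g & kap F g = g.
Proof.
move=> fF H0.
have [|g fE] := @face_monomial_dvd H f.
  move=> m mf; apply/subsetP => i iH; apply: contraT => im.
  have /mpolyP/(_ m) := H0 i iH; rewrite mcoeff0 mcoeff_kap.
  have /kap_idP/(_ m mf) smF := fF.
  rewrite subsetD1 smF im /= => /eqP; rewrite mcoeff_eq0 mf.
  by [].
exists g => //; apply: (mulfI (face_monomial_neq0 H)).
have [sHF|nsHF] := boolP (H \subset F).
  by rewrite -fE -[in RHS]fF fE rmorphM /= kap_face sHF.
have f0 : f = 0.
  by rewrite -fF fE rmorphM /= kap_face (negPf nsHF) mul0r.
move: fE; rewrite f0 => /esym/eqP; rewrite mulf_eq0 (negPf (face_monomial_neq0 H)).
by move=> /eqP ->; rewrite rmorph0.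
Qed.

(** The ideal of the coordinate subspace of F. *)
Definition coord_prime (F : {set T}) : prime_idealr S := rker (kap F).

Lemma mem_coord_prime F f : (f \in coord_prime F) = (kap F f == 0).
Proof. by []. Qed.

Lemma sub_kap_in (p : prime_idealr S) F f :
  (forall v, v \notin F -> var v \in p) -> f - kap F f \in p.
Proof.
move=> Fp; rewrite [f - _]mpolyE big_seq; apply: rpred_sum => m.
rewrite mcoeff_msupp mcoeffB mcoeff_kap.
case: ifP => [|/negbT/subsetPn[v vm vF] _]; first by rewrite subrr eqxx.
rewrite subr0 -mul_mpolyC; apply: idealMr.
have <- : (m - U_(enum_rank v) + U_(enum_rank v))%MM = m.
  by apply: submK; rewrite lep1mP; move: vm; rewrite inE.
by rewrite mpolyXD; apply: idealMr; apply: Fp.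
Qed.

Lemma kap_in (p : prime_idealr S) F f :
  (forall v, v \notin F -> var v \in p) -> (kap F f \in p) = (f \in p).
Proof.
move=> Fp; have h := @sub_kap_in p F f Fp; rewrite -[f in RHS](subrK (kap F f)).
by rewrite rpredDl.
Qed.

Lemma face_notin (p : prime_idealr S) H :
  (forall v, v \in H -> var v \notin p) -> face_monomial k H \notin p.
Proof. exact: prime_prod. Qed.
End Support.

(** * Primes of polynomial rings *)

Section Trichotomy.
Variables (A : idomainType).

Definition zero_prime (p : prime_idealr A) : Prop := forall h, h \in p -> h = 0.

(** The localization at p is a discrete valuation ring with uniformizer pi. *)
Definition dvr_prime (p : prime_idealr A) : Prop :=
  exists pi, [/\ pi \in p, pi != 0 & forall h, h != 0 ->
    exists n s u, [/\ s \notin p, u \notin p & s * h = u * pi ^+ n]].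

(** The sequence a, b is regular at p, so the localization has depth at least
two. *)
Definition deep_prime (p : prime_idealr A) : Prop :=
  exists a b, [/\ a \in p, b \in p, a != 0 & forall y y', b * y = a * y' ->
    exists s w, s \notin p /\ s * y = a * w].

Definition prime_trichotomy (p : prime_idealr A) : Prop :=
  [\/ zero_prime p, dvr_prime p | deep_prime p].
End Trichotomy.

Section PolyPrimes.
Variables (A : idomainType).
Implicit Types (q : prime_idealr A) (p : prime_idealr {poly A}).

Lemma coefs_clear q a (y : {poly A}) :
  (forall i, exists s w, s \notin q /\ s * y`_i = a * w) ->
  exists s w, s \notin q /\ s%:P * y = a%:P * w.
Proof.
elim/poly_ind: y => [|y c IHy] H.
  by exists 1, 0; rewrite idealr1 !mulr0.
have [i|s [w [sq e]]] := IHy.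
  by have := H i.+1; rewrite coefD coefMX coefC addr0.
have [t [z [tq e']]] := H 0%N.
move: e'; rewrite coefD coefMX coefC /= add0r => e'.
exists (s * t), (t%:P * w * 'X + (s * z)%:P).
rewrite prime_idealrM negb_or sq tq; split=> //.
transitivity (t%:P * (s%:P * y) * 'X + s%:P * (t * c)%:P).
  by rewrite !polyCM; ring.
by rewrite e e' !polyCM; ring.
Qed.

(** Gauss: the extension q[x] of a prime q is prime. *)
Lemma coefs_prime q (f y : {poly A}) :
  (forall n, (f * y)`_n \in q) -> (exists i, f`_i \notin q) ->
  forall j, y`_j \in q.
Proof.
move=> fy exf.
case: (ex_minnP exf) => i fi mini j; apply: contraT => yj.
have exy : exists j, y`_j \notin q by exists j.
case: (ex_minnP exy) => {yj}j yj minj.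
have := fy (i + j)%N; rewrite coefM.
have lt_i : (i < (i + j).+1)%N by rewrite ltnS leq_addr.
rewrite (bigD1 (Ordinal lt_i)) //= addKn rpredDr.
  by rewrite prime_idealrM (negPf fi) (negPf yj).
apply: rpred_sum => l li.
have [lt_li|lt_il|e] := ltngtP l i.
- have : f`_l \in q by apply: contraTT lt_li => /mini; rewrite leqNgt.
  by move=> h; rewrite mulrC; apply: idealMr.
- apply: idealMr; apply: contraT => /minj; rewrite leqNgt ltn_subLR.
    by rewrite ltn_add2r lt_il.
  by rewrite -ltnS.
- by case/eqP: li; apply/val_inj.
Qed.

(** The localization at p is a localization of K[x], K the fraction field of A: an
element g of p of least degree is a uniformizer by pseudo-division. *)
Lemma zero_contraction p :
  zero_prime (comap (@polyC A) p) -> zero_prime p \/ dvr_prime p.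
Proof.
move=> p0; have [?|np] := pselect (zero_prime p); [by left|right].
have exg : exists n, `[< exists g : {poly A}, [/\ g \in p, g != 0 & size g = n] >].
  apply: contrapT => H; apply: np => h hp; apply/eqP; apply: contraT => h0.
  by case: H; exists (size h); apply/asboolP; exists h.
case: (ex_minnP exg) => n /asboolP[g [gp g0 szg]] ming.
have c_in c : c != 0 -> c%:P \notin p.
  by move=> c0; apply: contra c0 => cp; apply/eqP; apply: p0.
have szg2 : (1 < size g)%N.
  rewrite ltnNge; apply/negP => /size1_polyC ge.
  have : g`_0 != 0 by apply: contra g0 => /eqP e; rewrite ge e.
  by move/c_in; rewrite -ge gp.
exists g; split=> //.
suff dvr m (h : {poly A}) : (size h < m)%N -> h != 0 ->
    exists n s u, [/\ s \notin p, u \notin p & s * h = u * g ^+ n].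
  by move=> h; apply: (dvr _ _ (ltnSn _)).
elim: m h => // m IHm h; rewrite ltnS => le_h h0.
have [hp|hp] := boolP (h \in p); last first.
  by exists 0%N, 1, h; rewrite idealr1 hp expr0 mul1r mulr1.
have e := Pdiv.Idomain.divp_eq h g.
set c := lead_coef g ^+ scalp h g in e.
have c0 : c != 0 by rewrite expf_neq0 // lead_coef_eq0.
have r0 : h %% g = 0.
  apply/eqP; apply: contraT => r0.
  have rp : h %% g \in p.
    have -> : h %% g = c *: h - h %/ g * g by rewrite e addrC addKr.
    by rewrite -mul_polyC rpredB // idealMr.
  have : (n <= size (h %% g)%R)%N by apply: ming; apply/asboolP; exists (h %% g).
  by rewrite -szg leqNgt Pdiv.Idomain.ltn_modpN0.
move: e; rewrite r0 addr0 => e.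
have s0 : h %/ g != 0.
  apply: contra h0 => /eqP s0; move/eqP: e; rewrite s0 mul0r.
  by rewrite -mul_polyC mulf_eq0 polyC_eq0 (negPf c0).
have [|k [s [u [sp up e']]]] := IHm (h %/ g) _ s0.
  apply: leq_trans le_h; rewrite -(size_scale h c0) e size_mul //.
  rewrite -subn1 -addnBA; last by apply: ltnW.
  by rewrite -addn1 leq_add2l subn_gt0.
exists k.+1, (s * c%:P), u; split=> //.
  by rewrite prime_idealrM negb_or sp c_in.
by rewrite -mulrA mul_polyC e mulrA e' exprSr mulrA.
Qed.

Lemma deep_contraction p : deep_prime (comap (@polyC A) p) -> deep_prime p.
Proof.
case=> a [b [ap bp a0 H]]; exists a%:P, b%:P.
rewrite polyC_eq0; split=> // y y' e.
have [i|s [w [sp ew]]] := @coefs_clear (comap (@polyC A) p) a y.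
  by apply: (H _ y'`_i); rewrite -!coefCM e.
by exists s%:P, w.
Qed.

(** Let q be the contraction of p, with uniformizer pi.  If f in p is not in q[x],
then pi, f is regular at p because q[x] is prime.  Otherwise p = q[x], and pi
remains a uniformizer: divide by it until some coefficient leaves q. *)
Lemma dvr_contraction p :
  dvr_prime (comap (@polyC A) p) -> dvr_prime p \/ deep_prime p.
Proof.
set q : prime_idealr A := comap (@polyC A) p.
case=> pi [piq pi0 H].
have divq c : c \in q -> exists s w, s \notin q /\ s * c = pi * w.
  move=> cq; have [->|c0] := eqVneq c 0.
    by exists 1, 0; rewrite idealr1 !mulr0.
  have [[|n] [s [u [sq uq e]]]] := H c c0.
    by have := idealMr s cq; rewrite e expr0 mulr1 (negPf uq).
  by exists s, (u * pi ^+ n); rewrite e exprS mulrCA.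
have [[f [fp exf]]|nf] := pselect (exists f : {poly A}, f \in p /\ exists i, f`_i \notin q).
  right; exists pi%:P, f; rewrite polyC_eq0; split=> // y y' e.
  have [i|s [w [sp ew]]] := @coefs_clear q pi y; last by exists s%:P, w.
  apply: divq; apply: (@coefs_prime q f) => // n.
  by rewrite e coefCM mulrC; apply: idealMr.
left; exists pi%:P; rewrite polyC_eq0; split=> //.
suff dvr (h : {poly A}) : h != 0 ->
    exists n s u, [/\ s \notin p, u \notin p & s * h = u * pi%:P ^+ n].
  by move=> h; apply: dvr.
move=> h0.
have memp (f : {poly A}) : (exists i, f`_i \notin q) -> f \notin p.
  by move=> exf; apply/negP => fp; apply: nf; exists f.
have [i hi] : exists i, h`_i != 0.
  by exists (size h).-1; rewrite -[_`_ _]/(lead_coef h) lead_coef_eq0.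
have [N [s [u [sq uq e]]]] := H _ hi.
elim: N h s u h0 hi sq uq e => [|N IHN] h s u h0 hi sq uq e.
  exists 0%N, 1, h; rewrite idealr1 expr0 mul1r mulr1; split=> //.
  apply: memp; exists i; apply: contra uq => /(idealMr s).
  by rewrite e expr0 mulr1.
have [/memp hp|nh] := pselect (exists i, h`_i \notin q).
  by exists 0%N, 1, h; rewrite idealr1 expr0 mul1r mulr1.
have [j|s' [w [s'q ew]]] := @coefs_clear q pi h.
  by apply: divq; apply: contraT => hj; case: nh; exists j.
have ewi : s * w`_i = (s' * u) * pi ^+ N.
  apply: (mulfI pi0); rewrite mulrCA -coefCM -ew coefCM mulrCA e exprS.
  by rewrite !mulrA; congr (_ * _); rewrite mulrC mulrA.
have s'u : s' * u \notin q by rewrite prime_idealrM negb_or s'q.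
have q0 c : c \notin q -> c != 0 by apply: contraNneq => ->; apply: idealr0.
have wi : w`_i != 0.
  apply: contraTneq isT => wi0; move: ewi; rewrite wi0 mulr0 => /esym/eqP.
  by rewrite mulf_eq0 expf_eq0 (negPf pi0) andbF (negPf (q0 _ s'u)).
have w0 : w != 0 by apply: contraNneq wi => ->; rewrite coef0.
have [n [s2 [u2 [s2p u2p e2]]]] := IHN w s (s' * u) w0 wi sq s'u ewi.
exists n.+1, (s2 * s'%:P), u2; split=> //.
  by rewrite prime_idealrM negb_or s2p.
by rewrite -mulrA ew mulrCA e2 exprS mulrCA.
Qed.

(** This replaces unique factorization, by which the primes of the second kind
would be the principal ones. *)
Lemma prime_trichotomy_poly :
  (forall q, prime_trichotomy q) -> forall p, prime_trichotomy p.
Proof.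
move=> H p; case: (H (comap (@polyC A) p)).
- by case/zero_contraction; [apply: Or31 | apply: Or32].
- by case/dvr_contraction; [apply: Or32 | apply: Or33].
- by move/deep_contraction; apply: Or33.
Qed.
End PolyPrimes.

Lemma mpoly_rmorphism_ext n (R : comNzRingType) (B : nzRingType)
    (f g : {rmorphism {mpoly R[n]} -> B}) :
  (forall c, f c%:MP = g c%:MP) -> (forall i, f 'X_i = g 'X_i) -> f =1 g.
Proof.
move=> fgC fgX h; rewrite [h]mpolyE !rmorph_sum; apply: eq_bigr => m _.
rewrite -mul_mpolyC !rmorphM fgC mpolyXE_id !rmorph_prod; congr (_ * _).
by apply: eq_bigr => i _; rewrite !rmorphXn /= fgX.
Qed.

(** The ring A is the subring generated by the variables of U, built as an
iterated polynomial ring so that the trichotomy climbs one variable at a time. *)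
Lemma subset_ring_trichotomy (k : fieldType) (T : finType) (U : {set T}) :
  exists (A : idomainType) (i : {rmorphism A -> {mpoly k[#|T|]}})
    (r : {rmorphism {mpoly k[#|T|]} -> A}),
    [/\ cancel i r, forall f, i (r f) = kap U f
      & forall p : prime_idealr A, prime_trichotomy p].
Proof.
have [n] := ubnP #|U|; elim: n U => // n IHn U; rewrite ltnS => le_U.
have [->|[v vU]] := set_0Vmem U.
  exists k, (@mpolyC _ _), (mcoeff 0%MM); split.
  - exact: mpolyCK.
  - apply: (@mpoly_rmorphism_ext _ _ _ (@mpolyC _ _ \o mcoeff 0%MM) (kap set0)).
      by move=> c /=; rewrite mpolyCK /kap mmapC.
    move=> i; rewrite /= mcoeffX mnm1_eq0 mpolyC0.
    by rewrite kapXU inE.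
  - move=> p; apply: Or31 => h hp; apply/eqP; apply: contraT => h0.
    by have := idealr1 p; rewrite -(mulVf h0) idealMr.
have [|A [i' [r' [r'K i'r' tri]]]] := IHn (U :\ v).
  by move: le_U; rewrite (cardsD1 v U) vU.
pose i : {rmorphism {poly A} -> {mpoly k[#|T|]}} :=
  horner_eval (var k v) \o map_poly i'.
pose r : {rmorphism {mpoly k[#|T|]} -> {poly A}} :=
  mmap (@polyC _ \o (r' \o @mpolyC _ _))
    (fun j => if enum_val j == v then 'X else (r' 'X_j)%:P).
have rC c : r c%:MP = (r' c%:MP)%:P by rewrite /r /= mmapC.
have rX j : r 'X_j = if enum_val j == v then 'X else (r' 'X_j)%:P.
  by rewrite /r /= mmapX mmap1U.
have iC c : i c%:P = i' c by rewrite /i /= /horner_eval map_polyC hornerC.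
have iX : i 'X = var k v by rewrite /i /= /horner_eval map_polyX hornerX.
have kC F c : kap F (c%:MP : {mpoly k[#|T|]}) = c%:MP by rewrite /kap mmapC.
have rk : r \o kap (U :\ v) =1 @polyC _ \o r'.
  apply: mpoly_rmorphism_ext => [c|j] /=; first by rewrite kC rC.
  have r0 : enum_val j \notin U :\ v -> r' 'X_j = 0.
    move=> jU; rewrite -[LHS]r'K i'r'.
    by rewrite kapXU (negPf jU) rmorph0.
  rewrite kapXU.
  case: ifP => [jU|/negbT/r0->]; last by rewrite rmorph0 polyC0.
  by rewrite rX; move: jU; rewrite !inE => /andP[/negPf-> _].
exists {poly A}, i, r; split; last exact: prime_trichotomy_poly.
  elim/poly_ind => [|p c IHp]; first by rewrite !rmorph0.
  rewrite !rmorphD !rmorphM IHp iX iC; congr (_ * _ + _).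
    by rewrite /var rX enum_rankK eqxx.
  by rewrite -[c in LHS]r'K i'r' -[r _]/((r \o kap _) _) rk /= r'K.
apply: (@mpoly_rmorphism_ext _ _ _ (i \o r) (kap U)) => [c|j].
  by rewrite -[LHS]/(i (r _)) rC iC i'r' /= !kC.
rewrite -[LHS]/(i (r _)) rX -[RHS]/(kap U _) kapXU.
case: eqP => [jv|/eqP jv]; first by rewrite iX jv vU -jv /var enum_valK.
by rewrite iC i'r' kapXU !inE jv.
Qed.

(** * Dimension of coordinate subspaces *)

Section Dimension.
Variables (k : fieldType) (T : finType).
Local Notation S := {mpoly k[#|T|]}.
Implicit Types (F : {set T}) (s : seq S).

(** The base-E digits of t serve as exponents, so that the monomials in the
entries of s are numbered by a single integer. *)
Fixpoint digit_prod (E : nat) s (t : nat) : S :=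
  if s is a :: s' then a ^+ (t %% E) * digit_prod E s' (t %/ E) else 1.

Lemma sum_digit_prod E a s (c : nat -> k) :
  \sum_(0 <= t < E ^ (size s).+1) c t *: digit_prod E (a :: s) t
  = \sum_(e < E) a ^+ e *
      \sum_(0 <= t < E ^ size s) c (t * E + e)%N *: digit_prod E s t.
Proof.
under [RHS]eq_bigr do rewrite mulr_sumr.
rewrite expnSr big_nat_mul [RHS]exchange_big /=; apply: eq_bigr => t _.
rewrite mulSnr -{1}[(t * E)%N]add0n big_addn addKn big_mkord.
apply: eq_bigr => e _; rewrite addnC modnMDl divnMDl; last first.
  by apply: leq_ltn_trans (ltn_ord e).
by rewrite modn_small // divn_small // addn0 -scalerAr.
Qed.

(** Reading a relation modulo Q 0 by increasing powers of the first entry a, its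
lowest nonzero coefficient lies in Q 1 since a is in Q 1 but not in Q 0; so the
relation loses one variable each time the prime grows. *)
Lemma chain_no_relation E s (Q : nat -> prime_idealr S) (c : nat -> k) :
  (forall i, (i < size s)%N -> {subset Q i <= Q i.+1}) ->
  (forall i, (i < size s)%N -> (s`_i \in Q i.+1) && (s`_i \notin Q i)) ->
  \sum_(0 <= t < E ^ size s) c t *: digit_prod E s t \in Q 0%N ->
  forall t, (t < E ^ size s)%N -> c t = 0.
Proof.
elim: s Q c => [|a s IHs] Q c sub ltQ.
  rewrite big_nat1 /= => c0 t; rewrite ltnS leqn0 => /eqP->.
  apply/eqP; apply: contraT => cn0; have := idealr1 (Q 0%N).
  by rewrite -[1](@scalerK _ _ _ cn0) -mul_mpolyC idealMr.
rewrite sum_digit_prod; 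
pose B e := \sum_(0 <= t < E ^ size s) c (t * E + e)%N *: digit_prod E s t.
rewrite -[X in X \in _]/(\sum_(e < E) a ^+ e * B e).
have /andP[aQ1 aQ0] := ltQ 0%N isT.
move=> sumQ.
have IH e : B e \in Q 1%N -> forall t, (t < E ^ size s)%N -> c (t * E + e)%N = 0.
  by apply: (IHs (fun i => Q i.+1)) => i lt_i; [apply: sub | apply: ltQ].
have H e : (e < E)%N -> forall t, (t < E ^ size s)%N -> c (t * E + e)%N = 0.
  have [n] := ubnP e; elim: n e => // n IHn e; rewrite ltnS => le_e lt_e.
  apply: IH; move: sumQ.
  rewrite (bigID (fun l : 'I_E => (l < e)%N)) /= big1 ?add0r => [|l lt_l]; last first.
    rewrite /B big1_seq ?mulr0 // => t /andP[_]; rewrite mem_index_iota => lt_t.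
    by rewrite IHn ?scale0r // (leq_trans lt_l).
  have -> : \sum_(l < E | ~~ (l < e)%N) a ^+ l * B l
     = a ^+ e * (B e + a * \sum_(l < E | (e < l)%N) a ^+ (l - e.+1) * B l).
    rewrite (bigD1 (Ordinal lt_e)) /= ?ltnn // mulrDr; congr (_ + _).
    rewrite mulr_sumr mulr_sumr; apply: eq_big => [l|l].
      by rewrite -leqNgt [RHS]ltn_neqAle andbC -val_eqE /= eq_sym.
    case/andP; rewrite -leqNgt => le_el le; rewrite !mulrA -exprSr -exprD.
    rewrite subnKC // ltn_neqAle le_el andbT eq_sym.
    by rewrite -val_eqE in le.
  rewrite prime_idealrM (negPf (primeX _ aQ0)) /= => /(sub 0%N isT).
  by rewrite rpredDr // mulrC idealMr.
move=> t; rewrite /= expnSr => lt_t.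
have E0 : (0 < E)%N by case: (E) lt_t; rewrite // muln0.
by rewrite (divn_eq t E) H ?ltn_mod // ltn_divLR.
Qed.

Lemma msizeM_bound (f g : S) x y :
  (msize f <= x.+1)%N -> (msize g <= y.+1)%N -> (msize (f * g) <= (x + y).+1)%N.
Proof.
move=> le_f le_g; have [->|f0] := eqVneq f 0; first by rewrite mul0r msize0.
have [->|g0] := eqVneq g 0; first by rewrite mulr0 msize0.
rewrite msizeM // -ltnS prednK; last by rewrite addn_gt0 lt0n msize_poly_eq0 f0.
by rewrite -addnS -addSn leq_add.
Qed.

Lemma msize_digit_prod E d s t : (0 < E)%N ->
  (forall a, a \in s -> (msize a <= d.+1)%N) ->
  (msize (digit_prod E s t) <= (size s * (E * d)).+1)%N.
Proof.
move=> E0; elim: s t => [|a s IHs] t H /=; first by rewrite msize1.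
rewrite mulSn; apply: msizeM_bound; last first.
  by apply: IHs => b bs; apply: H; rewrite inE bs orbT.
apply: (@leq_trans (t %% E * d).+1); last first.
  by rewrite ltnS leq_mul2r ltnW ?orbT // ltn_mod.
elim: (t %% E)%N => [|n IHn]; first by rewrite expr0 msize1.
by rewrite exprS mulSn; apply: msizeM_bound => //; apply: H; rewrite mem_head.
Qed.

(** Counting: the E ^ size s products have degree linear in E, so after restriction
to the variables of F they live in a space of dimension O(E ^ #|F|). *)
Lemma coordinate_relation F s : (#|F| < size s)%N ->
  exists E, exists2 c : nat -> k,
    (exists2 t, (t < E ^ size s)%N & c t != 0)
    & kap F (\sum_(0 <= t < E ^ size s) c t *: digit_prod E s t) = 0.
Proof.
move=> lt_Fs; pose d := (\max_(a <- s) msize a)%N.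
have dP a : a \in s -> (msize a <= d.+1)%N.
  by move=> as_; rewrite leqW // /d (big_rem a) //= leq_maxl.
(* Restricted degrees stay below D, and D <= E * K; the choice of E gives
   (E * K) ^ #|F| < E ^ (#|F| + 1). *)
pose K := (size s * d).+1; pose E := (K ^ #|F|).+1.
pose D := (size s * (E * d)).+1.
pose mn (g : {ffun {x : T | x \in F} -> 'I_D}) : 'X_{1..#|T|} :=
  [multinom (if insub (enum_val i) is Some x then g x : nat else 0%N) | i < #|T|].
have mnP (m : 'X_{1..#|T|}) : supp m \subset F -> (mdeg m < D)%N ->
    exists g, mn g = m.
  move=> smF ltmD.
  have lem i : (m i < D)%N.
    by apply: leq_ltn_trans ltmD; rewrite mdegE (bigD1 i) //= leq_addr.
  exists [ffun x => inord (m (enum_rank (val x)))].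
  apply/mnmP => i; rewrite mnmE; case: insubP => [x _ ex|iF].
    by rewrite ffunE inordK // ex enum_valK.
  apply/esym/eqP; apply: contraNT iF => mi; apply: (subsetP smF).
  by rewrite inE enum_valK.
pose M := \matrix_(t < E ^ size s, q < #|{ffun {x : T | x \in F} -> 'I_D}|)
  (kap F (digit_prod E s t))@_(mn (enum_val q)).
have lt_card : (#|{ffun {x : T | x \in F} -> 'I_D}| < E ^ size s)%N.
  rewrite card_ffun card_ord card_sig.
  have -> : #|[pred x in F]| = #|F| by apply: eq_card.
  apply: (@leq_ltn_trans ((E * K) ^ #|F|)).
    case: #|F| => // j; rewrite leq_exp2r //.
    by rewrite /D /K mulnS mulnCA -add1n leq_add2r.
  rewrite expnMn; apply: (@leq_trans (E ^ #|F|.+1)); last by rewrite leq_pexp2l.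
  by rewrite expnSr ltn_pmul2l // expn_gt0.
have kerM : kermx M != 0.
  rewrite -mxrank_eq0 mxrank_ker subn_eq0 -ltnNge.
  exact: leq_ltn_trans (rank_leq_col _) lt_card.
pose u := nz_row (kermx M).
have uM : u *m M = 0 by apply/sub_kermxP/nz_row_sub.
have /rV0Pn[t0 ut0] : u != 0 by rewrite nz_row_eq0.
pose c t := if insub t is Some t' then u 0 t' else 0.
have cE (t : 'I_(E ^ size s)) : c t = u 0 t by rewrite /c valK.
exists E, c; first by exists t0; rewrite ?cE.
apply/mpolyP => m; rewrite mcoeff0 big_mkord mcoeff_kap raddf_sum /=.
case: ifP => // smF.
have [ltmD|leDm] := ltnP (mdeg m) D; last first.
  rewrite big1 // => t _; rewrite mcoeffZ memN_msupp_eq0 ?mulr0 //.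
  by apply: msize_mdeg_ge; apply: leq_trans leDm; apply: msize_digit_prod.
have [g gm] := mnP m smF ltmD.
have /matrixP/(_ 0 (enum_rank g)) := uM; rewrite [RHS]mxE [LHS]mxE => e0.
apply: etrans e0; apply: eq_bigr => t _; rewrite mcoeffZ cE mxE enum_rankK gm.
by rewrite mcoeff_kap smF.
Qed.

(** A longer chain would, by picking an element at each step, give #|F| + 1 elements
satisfying no relation modulo the first prime, against the count above. *)
Lemma coordinate_chain_length F d (Q : nat -> prime_idealr S) :
  {subset coord_prime k F <= Q 0%N} ->
  (forall i, (i < d)%N -> {subset Q i <= Q i.+1}) ->
  (forall i, (i < d)%N -> exists2 a, a \in Q i.+1 & a \notin Q i) ->
  (d <= #|F|)%N.
Proof.
move=> FQ sub ltQ; rewrite leqNgt; apply/negP => lt_Fd.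
have H i : exists a, (i < d)%N -> (a \in Q i.+1) && (a \notin Q i).
  have [/ltQ[a aQ aNQ]|_] := ltnP i d; last by exists 0.
  by exists a => _; rewrite aQ.
have [a aP] := choice H.
have szs : size (mkseq a d) = d by rewrite size_mkseq.
have [|E [c [t lt_t ct] ker]] := @coordinate_relation F (mkseq a d).
  by rewrite szs.
have := @chain_no_relation E (mkseq a d) Q c.
rewrite szs in lt_t *; move=> /(_ sub) H'.
move: ct; rewrite H' ?eqxx // => [i lt_i|].
  by rewrite nth_mkseq // aP.
by apply: FQ; rewrite mem_coord_prime; move: ker; rewrite szs => ->.
Qed.
End Dimension.

(** * Modules spanned by monomials *)

(** Write r(G) for the size of a largest face containing G; long Delta b is
b <= r(G). *)
Definition long (T : finType) (Delta : {set {set T}}) (b : nat) : pred {set T} :=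
  fun G => [exists F in Delta, (b <= #|F|)%N && (G \subset F)].

(** r(G) = b. *)
Definition layer (T : finType) (Delta : {set {set T}}) (b : nat) : pred {set T} :=
  fun G => long Delta b G && ~~ long Delta b.+1 G.

(** Coordinates on a relative Stanley-Reisner module: N has the monomials with
support in P as a basis, every other monomial that arises in a product being
discarded. *)
Definition monomial_coords (k : fieldType) (T : finType) (P : pred {set T})
    (N : lmodType {mpoly k[#|T|]}) (psi : N -> {mpoly k[#|T|]}) : Prop :=
  [/\ zmod_morphism psi, injective psi, forall x, part P (psi x) = psi x,
      forall f, part P f = f -> exists x, psi x = f
    & forall s x, psi (s *: x) = part P (s * psi x)].

Section Layer.
Variables (k : fieldType) (T : finType) (Delta : {set {set T}}) (j : nat).
Hypothesis Delta_down :
  forall F G : {set T}, F \in Delta -> G \subset F -> G \in Delta.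
Hypothesis Delta_conn : exchange_connected Delta.
Local Notation S := {mpoly k[#|T|]}.
Local Notation R := (layer Delta j).
Local Notation fm := (face_monomial k).
Implicit Types (F G H U X Y : {set T}).

Variables (N : lmodType S) (psi : N -> S).
Hypothesis psiP : monomial_coords R psi.

Lemma longP b G :
  reflect (exists F, [/\ F \in Delta, (b <= #|F|)%N & G \subset F]) (long Delta b G).
Proof.
apply: (iffP exists_inP) => [[F FD /andP[cF sF]]|[F [FD cF sF]]].
  by exists F.
by exists F => //; rewrite cF.
Qed.

Lemma longS b G H : G \subset H -> long Delta b H -> long Delta b G.
Proof.
move=> sGH /longP[F [FD cF sHF]]; apply/longP; exists F; split=> //.
exact: subset_trans sHF.
Qed.

Definition top_face F := [&& F \in Delta, #|F| == j & ~~ long Delta j.+1 F].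

Lemma layer_up G H F : R G -> G \subset H -> H \subset F -> F \in Delta ->
  #|F| = j -> R H.
Proof.
case/andP=> _ nG sGH sHF FD cF; apply/andP; split.
  by apply/longP; exists F; rewrite cF.
by apply: contra nG; apply: longS.
Qed.

Lemma layer_top G F : R G -> G \subset F -> F \in Delta -> #|F| = j -> top_face F.
Proof.
case/andP=> _ nG sGF FD cF; rewrite /top_face FD cF eqxx.
by apply: contra nG; apply: longS.
Qed.

Lemma layer_top_face G : R G -> exists2 F, top_face F & G \subset F.
Proof.
move=> RG; have /andP[/longP[F [FD le_jF sGF]] nl] := RG.
exists F => //; apply: (layer_top RG sGF FD); apply/eqP.
rewrite eqn_leq le_jF andbT leqNgt; apply: contra nl => lt_jF.
by apply/longP; exists F.
Qed.

Lemma top_face_layer F : top_face F -> R F.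
Proof. by case/and3P=> FD /eqP cF nF; rewrite /layer nF andbT; apply/longP; exists F; rewrite cF. Qed.

(** Over all top faces F, the maps coord F embed N in the direct sum of the
polynomial rings on the sets F. *)
Definition coord F x : S := kap F (psi x).

Lemma coordK F x : kap F (coord F x) = coord F x.
Proof. by rewrite /coord kap_kap setIid. Qed.

Lemma supp_layer x m : m \in msupp (psi x) -> R (supp m).
Proof. by case: psiP => _ _ /(_ x) + _ _ => /part_idP; apply. Qed.

Lemma mcoeff_layer_mul s x m F : F \in Delta -> #|F| = j -> supp m \subset F ->
  m \in msupp (s * psi x) -> R (supp m).
Proof.
move=> FD cF sF /msupp_mul[m1 [m2 [_ m2x em]]].
apply: (layer_up (supp_layer m2x) _ sF FD cF).
by rewrite em suppD subsetUr.
Qed.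

Lemma coordZ F s x : top_face F -> coord F (s *: x) = kap F s * coord F x.
Proof.
case/and3P=> FD /eqP cF _; case: psiP => _ _ _ _ psiZ.
rewrite /coord psiZ -rmorphM; apply/mpolyP => m.
rewrite !mcoeff_kap mcoeff_part; case: ifP => // sF; case: ifP => // nR.
by rewrite memN_msupp_eq0 //; apply: contraFN nR; apply: mcoeff_layer_mul FD cF sF.
Qed.

Lemma coord_inj x y : (forall F, top_face F -> coord F x = coord F y) -> x = y.
Proof.
move=> H; case: psiP => _ inj idR _ _; apply: inj; apply/mpolyP => m.
rewrite -(idR x) -(idR y) !mcoeff_part; case: ifP => // Rm.
have [F Ft sF] := layer_top_face Rm.
by have /mpolyP/(_ m) := H F Ft; rewrite !mcoeff_kap sF.
Qed.

Lemma coord0 F : coord F (0 : N) = 0.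
Proof.
case: psiP => psiB _ _ _ _; rewrite /coord.
by have := psiB 0 0; rewrite !subrr => ->; rewrite rmorph0.
Qed.

Lemma coord_sum F (I : Type) (r : seq I) (f : I -> N) :
  coord F (\sum_(i <- r) f i) = \sum_(i <- r) coord F (f i).
Proof.
case: psiP => psiB _ _ _ _.
have psiD x y : coord F (x + y) = coord F x + coord F y.
  have e0 z : psi (- z) = - psi z.
    by have := psiB 0 z; rewrite sub0r => ->; have := psiB 0 0; rewrite !subrr => ->; rewrite sub0r.
  by rewrite /coord -[y in LHS]opprK psiB e0 opprK rmorphD.
elim: r => [|i r IHr]; first by rewrite !big_nil coord0.
by rewrite !big_cons psiD IHr.
Qed.

Lemma layer_monomial G : R G -> exists x, psi x = fm G.
Proof.
move=> RG; case: psiP => _ _ _ surj _; apply: surj; apply/part_idP => m.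
by rewrite face_monomialE msuppX inE => /eqP->; rewrite supp_set_mnm.
Qed.

(** Otherwise every top face F has an element outside q that vanishes on the
coordinate subspace of F, and the product of these elements kills N. *)
Lemma annihilator_prime (q : prime_idealr S) :
  (forall a, (forall x : N, a *: x = 0) -> a \in q) ->
  exists2 F, top_face F & forall v, v \notin F -> var k v \in q.
Proof.
move=> annq; apply: contrapT => nF.
have a_ex F : exists a, top_face F -> (a \notin q) /\ kap F a = 0.
  have [Ft|_] := boolP (top_face F); last by exists 0.
  apply: contrapT => na; apply: nF; exists F => // v vF.
  apply: contraT => vq; case: na; exists (var k v) => _.
  by rewrite kap_var (negPf vF).
have [a aP] := choice a_ex.
suff : \prod_(F | top_face F) a F \in q.
  by apply/negP; apply: prime_prod => F /aP[].
apply: annq => x; apply: coord_inj => F Ft.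
rewrite coordZ // coord0 (bigD1 F) //= rmorphM /=.
by have [_ ->] := aP F Ft; rewrite !mul0r.
Qed.

Section AtPrime.
Variables (p : prime_idealr S) (U : {set T}).
Hypothesis memU : forall v, (var k v \in p) = (v \notin U).

Lemma faceU_notin : fm U \notin p.
Proof. by apply: face_notin => v vU; rewrite memU vU. Qed.

Lemma kap_faceU F : kap F (fm U) = if U \subset F then fm U else 0.
Proof. exact: kap_face. Qed.

Lemma kap_in_at G f : U \subset G -> (kap G f \in p) = (f \in p).
Proof.
move=> sUG; apply: kap_in => v vG; rewrite memU.
by apply: contra vG; apply: (subsetP sUG).
Qed.

(** Stands in for Nakayama's lemma.  Locally fm U is a unit, so only the monomials
with support containing U count.  If G is minimal among those supports, N
restricted to the coordinate subspace of G is generated by fm G, which is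
therefore not in p N. *)
Lemma locally_nonzero F0 (s : seq S) : top_face F0 -> U \subset F0 ->
  {subset s <= p} ->
  exists x : N, forall u, u \notin p -> ~ in_span s (u *: x).
Proof.
move=> F0t sUF0 sp.
pose P := [pred G : {set T} | (U \subset G) && R G].
have PF0 : P F0 by rewrite /= sUF0 top_face_layer.
case: (@arg_minnP _ F0 P (fun G => #|G|) PF0) => G /andP[sUG RG] minG.
have [x psix] := layer_monomial RG; exists x => u up [y e].
have [F Ft sGF] := layer_top_face RG.
have /and3P[FD /eqP cF _] := Ft.
have g_ex i : exists g, fm U * kap G (psi (y i)) = fm G * g.
  apply: face_monomial_dvd => m /msupp_mul[m1 [m2 [m1U m2y ->]]].
  rewrite suppD; have -> : supp m1 = U.
    by move: m1U; rewrite face_monomialE msuppX inE => /eqP->; rewrite supp_set_mnm.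
  move: m2y; rewrite mcoeff_msupp mcoeff_kap; case: ifP => [sm2|]; last by rewrite eqxx.
  rewrite -mcoeff_msupp => /supp_layer Rm2.
  have sUm : U :|: supp m2 \subset G by rewrite subUset sUG.
  have /minG le_G : P (U :|: supp m2).
    rewrite /= subsetUl /=; apply: layer_up Rm2 (subsetUr _ _) _ FD cF.
    exact: subset_trans sGF.
  suff /eqP -> : U :|: supp m2 == G by [].
  by rewrite eqEcard sUm.
have [g gP] := choice g_ex.
have kapZ t z : kap G (coord F (t *: z)) = kap G t * kap G (psi z).
  by rewrite coordZ // rmorphM /= /coord !kap_kapS.
have eG : fm U * kap G u = \sum_(i < size s) kap G s`_i * g i.
  apply: (mulfI (face_monomial_neq0 k G)).
  transitivity (fm U * kap G (coord F (u *: x))).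
    by rewrite kapZ psix kap_face subxx; ring.
  rewrite e coord_sum rmorph_sum !mulr_sumr; apply: eq_bigr => i _ /=.
  by rewrite kapZ mulrCA gP; ring.
have : fm U * kap G u \in p.
  rewrite eG; apply: rpred_sum => i _; rewrite mulrC; apply: idealMr.
  by rewrite kap_in_at // sp // mem_nth.
by rewrite prime_idealrM (negPf faceU_notin) kap_in_at // (negPf up).
Qed.

Lemma locally_regular1 a :
  (forall F, top_face F -> U \subset F -> kap F a != 0) ->
  forall x : N, a *: x = 0 -> fm U *: x = 0.
Proof.
move=> a0 x ax; apply: coord_inj => F Ft; rewrite coord0 coordZ // kap_faceU.
case: ifP => sUF; last by rewrite mul0r.
have /eqP := congr1 (coord F) ax; rewrite coord0 coordZ //.
by rewrite mulf_eq0 (negPf (a0 _ _ _)) //= => /eqP->; rewrite mulr0.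
Qed.

(** Suppose b * y = a * y'.  On each top face F through U, a restricts to the
monomial fm (F :\: U), and b restricts to a nonzero element on F :\ i for each i
of F outside U; so a divides y there. *)
Section RegularPair.
Variables (a b : S).
Hypothesis kap_a : forall F, top_face F -> U \subset F -> kap F a = fm (F :\: U).
Hypothesis kap_b : forall G, U \subset G -> #|G|.+1 = j -> kap G b != 0.
Variables (y y' : N).
Hypothesis eq_ab : b *: y = a *: y'.

Lemma quotient_coord F : top_face F -> U \subset F ->
  exists g, [/\ coord F y = fm (F :\: U) * g, kap F g = g
              & kap F b * g = coord F y'].
Proof.
move=> Ft sUF; have /and3P[FD /eqP cF _] := Ft.
have e : kap F b * coord F y = fm (F :\: U) * coord F y'.
  by have := congr1 (coord F) eq_ab; rewrite !coordZ // kap_a.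
have [|g eg gF] := @face_monomial_dvd_kap k T (F :\: U) F (coord F y) (coordK _ _).
  move=> i; rewrite inE => /andP[iU iF].
  have := congr1 (kap (F :\ i)) e; rewrite !rmorphM /= kap_face.
  rewrite (kap_kapS b (subsetDl F [set i])).
  have -> : F :\: U \subset F :\ i = false.
    by apply/negbTE/subsetPn; exists i; rewrite !inE ?eqxx ?iU.
  rewrite mul0r => /eqP; rewrite mulf_eq0 (negPf (kap_b _ _)).
  - by move/eqP.
  - by rewrite subsetD1 sUF.
  - by rewrite -cF (cardsD1 i F) iF.
exists g; split=> //; apply: (mulfI (face_monomial_neq0 k (F :\: U))).
by rewrite -e eg mulrCA.
Qed.

(** The coordinates of the candidate quotient (fm U *: y) / a. *)
Definition quot_coord F : S :=
  if pselect (top_face F /\ U \subset F) is left h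
  then fm U * projT1 (cid (quotient_coord h.1 h.2)) else 0.

Lemma quot_coordP F : top_face F ->
  [/\ kap F (quot_coord F) = quot_coord F,
      kap F a * quot_coord F = coord F (fm U *: y)
    & forall G, U \subset G -> G \subset F ->
        kap G b * kap G (quot_coord F) = kap G (fm U * psi y')].
Proof.
move=> Ft; rewrite /quot_coord; case: pselect => [[Ft' sUF]|nh].
  case: (cid _) => g /= [e1 e2 e3]; split.
  - by rewrite rmorphM /= kap_faceU sUF e2.
  - by rewrite coordZ // kap_a // kap_faceU sUF e1; ring.
  move=> G sUG sGF; rewrite !rmorphM /= mulrCA; congr (_ * _).
  by have := congr1 (kap G) e3; rewrite rmorphM /= /coord !kap_kapS.
have nsUF : U \subset F = false by apply/negP => sUF; apply: nh.
split; first by rewrite rmorph0.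
  by rewrite coordZ // kap_faceU nsUF mulr0 mul0r.
by move=> G sUG sGF; rewrite (subset_trans sUG sGF) in nsUF.
Qed.

Lemma supp_quot_coord F m : m \in msupp (quot_coord F) -> U \subset supp m.
Proof.
rewrite /quot_coord; case: pselect => [h|_]; last by rewrite msupp0.
case/msupp_mul => m1 [m2 [m1U _ ->]]; rewrite suppD.
move: m1U; rewrite face_monomialE msuppX inE => /eqP->.
by rewrite supp_set_mnm subsetUl.
Qed.

Lemma quot_coord_wall F G : top_face F -> U \subset G -> G \subset F ->
  #|G|.+1 = j -> ~~ R G -> kap G (quot_coord F) = 0.
Proof.
move=> Ft sUG sGF cG nRG.
have [_ _ /(_ G sUG sGF) e] := quot_coordP Ft.
apply: (mulfI (kap_b sUG cG)); rewrite e mulr0.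
have /and3P[FD /eqP cF _] := Ft.
apply/mpolyP => m; rewrite mcoeff0 mcoeff_kap; case: ifP => // smG.
apply: memN_msupp_eq0; apply: contra nRG => mS.
apply: (layer_up (mcoeff_layer_mul FD cF _ mS) smG sGF FD cF).
exact: subset_trans sGF.
Qed.

(** Two neighbouring faces X and Y share the wall X :&: Y, on which b times either
coordinate is the restriction of fm U * y'; b cancels.  If X is not a top face,
the wall is not in the layer, and that restriction is zero. *)
Lemma mcoeff_quot_coord_step X Y G m :
  exchange Delta G X Y -> #|X| = j -> U \subset G -> supp m \subset G ->
  (top_face X -> top_face Y -> (quot_coord X)@_m = (quot_coord Y)@_m)
  /\ (~~ top_face X -> top_face Y -> (quot_coord Y)@_m = 0).
Proof.
case/and5P=> XD YD sGX sGY /andP[/eqP cXY lt_I] cX sUG smG.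
have [->|neqXY] := eqVneq X Y; first by split=> // /negPf->.
have cI : #|X :&: Y|.+1 = j.
  apply/eqP; rewrite eqn_leq -{2}cX lt_I andbT -cX.
  rewrite (proper_card (_ : X :&: Y \proper X)) // properEneq subsetIl andbT.
  apply: contra neqXY => /eqP e; rewrite eqEcard cXY leqnn andbT.
  by rewrite -e subsetIr.
have sGI : G \subset X :&: Y by rewrite subsetI sGX.
have sUI := subset_trans sUG sGI; have smI := subset_trans smG sGI.
have coefE Z : (quot_coord Z)@_m = (kap (X :&: Y) (quot_coord Z))@_m.
  by rewrite mcoeff_kap smI.
split=> [Xt Yt|nXt Yt]; rewrite !coefE.
  congr (_ @_ _); apply: (mulfI (kap_b sUI cI)).
  have [_ _ ->] := quot_coordP Xt; rewrite ?subsetIl //.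
  by have [_ _ ->] := quot_coordP Yt; rewrite ?subsetIr.
have nRI : ~~ R (X :&: Y).
  by apply: contra nXt => RI; apply: layer_top RI (subsetIl _ _) XD cX.
by rewrite (quot_coord_wall Yt sUI (subsetIr _ _) cI nRI) mcoeff0.
Qed.

Lemma mcoeff_quot_coord_layer A F m : top_face A -> top_face F ->
  supp m \subset A -> supp m \subset F -> U \subset supp m -> R (supp m) ->
  (quot_coord F)@_m = (quot_coord A)@_m.
Proof.
move=> At Ft smA smF sUm Rm.
have /and3P[AD /eqP cA _] := At; have /and3P[FD /eqP cF _] := Ft.
have smI : supp m \subset A :&: F by rewrite subsetI smA.
have := Delta_conn AD FD (etrans cA (esym cF)).
pose P X := #|X| = j /\ (quot_coord X)@_m = (quot_coord A)@_m.
move/(@connect_invariant _ _ P) => H; apply: (proj2 (H _ _)) => // X Y exXY.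
case=> cX eX; have [HXY _] := mcoeff_quot_coord_step exXY cX
  (subset_trans sUm smI) smI.
have /and5P[XD YD sX sY /andP[/eqP cXY _]] := exXY.
split; first by rewrite -cXY.
rewrite -HXY // (layer_top Rm) -?cXY //; exact: subset_trans smI _.
Qed.

(** Here supp m lies in a face with more than j elements, hence in a face A of
size j that is not a top face, and an exchange sequence leads from A to F. *)
Lemma mcoeff_quot_coord_out F m : top_face F ->
  supp m \subset F -> U \subset supp m -> ~~ R (supp m) ->
  (quot_coord F)@_m = 0.
Proof.
move=> Ft smF sUm nRm; have /and3P[FD /eqP cF _] := Ft.
have : long Delta j.+1 (supp m).
  apply: contraR nRm => nl; rewrite /layer nl andbT.
  by apply/longP; exists F; rewrite cF.
case/longP=> C [CD lt_jC smC].
have [|A [smA sAC cA]] := @subset_interpolate T (supp m) C j smC.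
  by rewrite -{1}cF subset_leq_card //= ltnW.
have AD : A \in Delta := Delta_down CD sAC.
have nAt : ~~ top_face A.
  rewrite /top_face AD cA eqxx /= negbK; apply/longP; exists C.
  by split.
have smI : supp m \subset A :&: F by rewrite subsetI smA.
have := Delta_conn AD FD (etrans cA (esym cF)).
pose P X := #|X| = j /\ (top_face X -> (quot_coord X)@_m = 0).
move/(@connect_invariant _ _ P) => H; apply: (proj2 (H _ _)) => //; last first.
  by split=> // At; rewrite At in nAt.
move=> X Y exXY [cX eX].
have [HXY HXY'] := mcoeff_quot_coord_step exXY cX (subset_trans sUm smI) smI.
have /and5P[_ _ _ _ /andP[/eqP cXY _]] := exXY.
split=> [|Yt]; first by rewrite -cXY.
have [Xt|nXt] := boolP (top_face X); last exact: HXY'.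
by rewrite -HXY // eX.
Qed.

(** A family of coordinates comes from N when, at each monomial, the coordinates
on all top faces agree if the support is in the layer and vanish otherwise.  This
holds for the quotients by the two previous lemmas. *)
Lemma locally_regular2 : exists z, fm U *: y = a *: z.
Proof.
pose pf G := odflt set0 [pick F | top_face F && (G \subset F)].
have pfP G : R G -> top_face (pf G) /\ G \subset pf G.
  move=> RG; rewrite /pf; case: pickP => [F /andP[]|] //= nF.
  by have [F Ft sF] := layer_top_face RG; have := nF F; rewrite Ft sF.
pose f := \sum_(G | R G) part (pred1 G) (quot_coord (pf G)).
have fE m : f@_m = if R (supp m) then (quot_coord (pf (supp m)))@_m else 0.
  rewrite raddf_sum /=; under eq_bigr do rewrite mcoeff_part /= eq_sym.
  case: ifP => [Rm|nRm]; last first.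
    by rewrite big1 // => G RG; case: eqP => // Gm; rewrite -Gm RG in nRm.
  by rewrite (bigD1 (supp m)) //= eqxx big1 ?addr0 // => G /andP[_ /negPf->].
have qE F m : top_face F -> supp m \subset F -> (quot_coord F)@_m = f@_m.
  move=> Ft smF; rewrite fE.
  have [sUm|nsUm] := boolP (U \subset supp m); last first.
    have q0 X : (quot_coord X)@_m = 0.
      by apply: memN_msupp_eq0; apply: contra nsUm; apply: supp_quot_coord.
    by rewrite !q0 if_same.
  case: ifP => [Rm|/negbT nRm]; last exact: mcoeff_quot_coord_out.
  by have [At smA] := pfP _ Rm; apply: mcoeff_quot_coord_layer.
have [z zf] : exists z, psi z = f.
  case: psiP => _ _ _ surj _; apply: surj; apply/mpolyP => m.
  by rewrite mcoeff_part fE; case: (R _).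
exists z; apply: coord_inj => F Ft; have [qF <- _] := quot_coordP Ft.
rewrite coordZ //; congr (_ * _); rewrite -qF /coord zf.
by apply/mpolyP => m; rewrite !mcoeff_kap; case: ifP => // smF; rewrite qE.
Qed.

End RegularPair.

Lemma locally_regular_nil F0 : top_face F0 -> U \subset F0 ->
  locally_regular p N [::].
Proof. by move=> Ft sUF; split=> //; apply: locally_nonzero Ft sUF _. Qed.

Lemma locally_regular_seq1 F0 a : top_face F0 -> U \subset F0 -> a \in p ->
  (forall F, top_face F -> U \subset F -> kap F a != 0) ->
  locally_regular p N [:: a].
Proof.
move=> Ft sUF ap a0; split; last first.
  by apply: locally_nonzero Ft sUF _ => c; rewrite inE => /eqP->.
move=> [|//] x _ /in_span_nil e; exists (fm U); first exact: faceU_notin.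
exact/in_span_nil/(locally_regular1 a0).
Qed.

Lemma locally_regular_seq2 F0 a b : top_face F0 -> U \subset F0 ->
  a \in p -> b \in p ->
  (forall F, top_face F -> U \subset F -> kap F a != 0) ->
  (forall y y' : N, b *: y = a *: y' ->
     exists2 u, u \notin p & exists z, u *: y = a *: z) ->
  locally_regular p N [:: a; b].
Proof.
move=> Ft sUF ap bp a0 H; split; last first.
  by apply: locally_nonzero Ft sUF _ => c; rewrite !inE => /orP[] /eqP->.
move=> [|[|//]] x _ /=.
  move=> /in_span_nil e; exists (fm U); first exact: faceU_notin.
  exact/in_span_nil/(locally_regular1 a0).
case/in_span1 => y' /H[u up [z e]]; exists u => //.
by apply/in_span1; exists z.
Qed.

(** Every other top face misses an element of U, so that fm U vanishes on it: when
U itself is a top face, N is locally the polynomial ring on U. *)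
Lemma polynomial_regular_pair (A : idomainType) (i : {rmorphism A -> S})
    (r : {rmorphism S -> A}) (a b : A) :
  top_face U -> cancel i r -> (forall f, i (r f) = kap U f) ->
  (forall c c', b * c = a * c' -> exists s w, i s \notin p /\ s * c = a * w) ->
  forall y y' : N, i b *: y = i a *: y' ->
    exists2 u, u \notin p & exists z, u *: y = i a *: z.
Proof.
move=> Ut iK ir H y y' e.
have kapi c : kap U (i c) = i c by rewrite -ir iK.
have := congr1 (fun x => r (coord U x)) e.
rewrite !coordZ // !kapi !rmorphM !iK => /H[s [w [sp es]]].
have [x0 x0E] := layer_monomial (top_face_layer Ut).
exists (fm U * i s); first by rewrite prime_idealrM negb_or faceU_notin.
exists (i w *: x0); apply: coord_inj => F Ft.
rewrite !coordZ // rmorphM /= kap_faceU /coord x0E kap_faceU.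
have [sUF|_] := boolP (U \subset F); last by rewrite !(mul0r, mulr0).
have eFU : F = U.
  have /and3P[_ /eqP cF _] := Ft; have /and3P[_ /eqP cU _] := Ut.
  by apply/esym/eqP; rewrite eqEcard sUF cF cU leqnn.
rewrite {}eFU !kapi.
have := congr1 i es; rewrite !rmorphM ir kap_kap setIid => es'.
by rewrite -mulrA es'; ring.
Qed.

(** The elementary symmetric polynomial in the variables outside U, chosen because
on a face containing U with c further elements only one of its terms survives. *)
Definition elem_sym c : S :=
  \sum_(H : {set T} | [disjoint H & U] && (#|H| == c)) fm H.

Lemma elem_sym_in c : elem_sym c.+1 \in p.
Proof.
apply: rpred_sum => H /andP[dHU /eqP cH].
have [v vH] : exists v, v \in H by apply/set0Pn; rewrite -card_gt0 cH.
rewrite /face_monomial (bigD1 v) //= mulrC idealMr //.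
by rewrite memU (disjointFr dHU vH).
Qed.

Lemma kap_elem_sym F c : U \subset F -> (#|F :\: U| = c)%N ->
  kap F (elem_sym c) = fm (F :\: U).
Proof.
move=> sUF cF; rewrite rmorph_sum /= (bigD1 (F :\: U)) /=; last first.
  by rewrite cF eqxx andbT disjoints_subset setDE subsetIr.
rewrite kap_face subsetDl big1 ?addr0 // => H /andP[/andP[dHU /eqP cH] neqH].
rewrite kap_face; case: ifP => // sHF; case/eqP: neqH; apply/eqP.
by rewrite eqEcard subsetD sHF dHU cH cF leqnn.
Qed.

Definition outer_sum : S := \sum_(v | v \notin U) var k v.

Lemma outer_sum_in : outer_sum \in p.
Proof. by apply: rpred_sum => v vU; rewrite memU. Qed.

Lemma kap_outer_sum_neq0 G : (#|U| < #|G|)%N -> kap G outer_sum != 0.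
Proof.
move=> lt_UG; have [w] : exists w, w \in G :\: U.
  apply/set0Pn; rewrite setD_eq0; apply/negP => /subset_leq_card.
  by rewrite leqNgt lt_UG.
rewrite inE => /andP[wU wG]; apply/eqP => /mpolyP/(_ U_(enum_rank w)%MM)/eqP.
rewrite mcoeff0 rmorph_sum raddf_sum /= (bigD1 w) //= kap_var wG.
rewrite big1 ?addr0 => [|v /andP[_ vw]].
  by rewrite mcoeffX eqxx oner_eq0.
rewrite kap_var; case: ifP => _; last exact: mcoeff0.
by rewrite mcoeffX eq_mnm1 (inj_eq enum_rank_inj) (negPf vw).
Qed.

End AtPrime.

(** If p were contained in the coordinate prime of F :\ w, the variable of w would
divide every element of p modulo the coordinate prime of F.  An element of Q 1 of
least degree then shows that Q 1 contains this variable, whence Q 2 = Q 1. *)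
Lemma hyperplane_height1 (p : prime_idealr S) (Q : nat -> prime_idealr S) F w :
  w \in F -> (forall v, v \notin F -> var k v \in Q 0%N) ->
  {subset Q 0%N <= Q 1%N} -> {subset Q 1%N <= Q 2} ->
  (exists2 a, a \in Q 1%N & a \notin Q 0%N) ->
  (exists2 a, a \in Q 2 & a \notin Q 1%N) ->
  {subset Q 2 <= p} -> exists2 f, f \in p & kap (F :\ w) f != 0.
Proof.
move=> wF FQ0 sQ01 sQ12 [a aQ1 aQ0] [b bQ2 bQ1] sQ2p.
apply: contrapT => nf.
have kap0 f : f \in p -> kap (F :\ w) f = 0.
  by move=> fp; apply/eqP; apply: contraT => f0; case: nf; exists f.
have FQ1 v (vF : v \notin F) := sQ01 _ (FQ0 v vF).
have FQ2 v (vF : v \notin F) := sQ12 _ (FQ1 v vF).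
have dvd_w f : f \in p -> kap F f = f -> exists2 g, f = var k w * g & kap F g = g.
  move=> fp fF; rewrite -face_monomial1; apply: face_monomial_dvd_kap => // i.
  by rewrite inE => /eqP->; apply: kap0.
have wQ1 : var k w \in Q 1%N.
  suff H n f : (msize f < n)%N -> kap F f = f -> f != 0 -> f \in Q 1%N ->
      var k w \in Q 1%N.
    apply: (H _ (kap F a) (ltnSn _)); first by rewrite kap_kap setIid.
      by apply: contraNneq aQ0 => ka0; rewrite -(kap_in _ FQ0) ka0 rpred0.
    by rewrite kap_in.
  elim: n f => // n IHn f; rewrite ltnS => le_f fF f0 fQ1.
  have [g fg gF] := dvd_w f (sQ2p _ (sQ12 _ fQ1)) fF.
  have := fQ1; rewrite fg prime_idealrM => /orP[//|gQ1].
  have g0 : g != 0 by apply: contraNneq f0 => g0; rewrite fg g0 mulr0.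
  apply: (IHn g) => //; apply: leq_trans le_f.
  by rewrite fg msizeM // ?msizeX ?mdeg1 // -msize_poly_eq0 msizeX.
case/negP: bQ1; rewrite -(kap_in _ FQ1).
have [||g -> _] := dvd_w (kap F b).
- by apply: sQ2p; rewrite (kap_in _ FQ2).
- by rewrite kap_kap setIid.
by rewrite mulrC idealMr.
Qed.

(** Up to units, every nonzero element of the restricted ring is a power of pi, so
each nonzero prime below p contains pi, hence p. *)
Lemma dvr_height1 (A : idomainType) (i : {rmorphism A -> S})
    (r : {rmorphism S -> A}) (p : prime_idealr S) (Q : nat -> prime_idealr S) U :
  (forall f, i (r f) = kap U f) -> (forall v, v \notin U -> var k v \in Q 0%N) ->
  {subset Q 0%N <= Q 1%N} -> {subset Q 1%N <= Q 2} ->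
  (exists2 a, a \in Q 1%N & a \notin Q 0%N) ->
  (exists2 a, a \in Q 2 & a \notin Q 1%N) ->
  {subset Q 2 <= p} -> ~ dvr_prime (comap i p).
Proof.
move=> ir UQ0 sQ01 sQ12 [a aQ1 aQ0] [b bQ2 bQ1] sQ2p [pi [_ _ dvr]].
have UQ1 v (vU : v \notin U) := sQ01 _ (UQ0 v vU).
have UQ2 v (vU : v \notin U) := sQ12 _ (UQ1 v vU).
have sQ1p f : f \in Q 1%N -> f \in p by move=> /sQ12/sQ2p.
have piQ1 : i pi \in Q 1%N.
  have [|n [s [u [_ up e]]]] := dvr (r a).
    by apply: contraNneq aQ0 => ra0; rewrite -(kap_in _ UQ0) -ir ra0 rmorph0 rpred0.
  have : i u * i pi ^+ n \in Q 1%N.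
    by rewrite -rmorphXn -rmorphM -e rmorphM ir idealMr // kap_in.
  have uQ1 : i u \notin Q 1%N by apply: contra up; apply: sQ1p.
  rewrite prime_idealrM (negPf uQ1) /=; apply: contraLR => piQ1.
  exact: primeX.
have [|n [s [u [sp up e]]]] := dvr (r b).
  by apply: contraNneq bQ1 => rb0; rewrite -(kap_in _ UQ1) -ir rb0 rmorph0 rpred0.
have e' : i s * kap U b = i u * i pi ^+ n by rewrite -ir -rmorphM e rmorphM rmorphXn.
case: n e e' => [|n] e e'.
  case/negP: up; apply: sQ2p; rewrite -[i u]mulr1 -(expr0 (i pi)) -e'.
  by rewrite idealMr // kap_in.
have : i s * kap U b \in Q 1%N by rewrite e' exprS mulrCA mulrC idealMr.
rewrite prime_idealrM (kap_in _ UQ1) (negPf bQ1) orbF => /sQ1p.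
by rewrite -mem_comap (negPf sp).
Qed.

(** Let U be the set of variables outside p; every prime of the support of N inside
p contains the coordinate prime of a top face F0 that contains U.  The proof goes
by the number of elements of F0 outside U: none, one, or more. *)
Lemma layer_serre : serre 2 N.
Proof.
apply: serre_criterion => p d Q le_d annQ subQ ltQ sQp.
have [F0 F0t F0Q] := annihilator_prime (annQ 0%N ^~ (leq0n d)).
pose U := [set v | var k v \notin p].
have memU v : (var k v \in p) = (v \notin U) by rewrite inE negbK.
have sUF0 : U \subset F0.
  by apply/subsetP => v; apply: contraTT => /F0Q/sQp; rewrite inE negbK.
have /and3P[F0D /eqP cF0 _] := F0t.
have cFU F : top_face F -> U \subset F -> #|F :\: U| = (j - #|U|)%N.
  by case/and3P=> _ /eqP cF _ sUF; rewrite cardsD (setIidPr sUF) cF.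
have [eFU|neqFU] := eqVneq U F0.
  (* N is locally a polynomial ring on U, and the trichotomy applies. *)
  have Ut : top_face U by rewrite eFU.
  have onlyU F a : top_face F -> U \subset F -> kap U a != 0 -> kap F a != 0.
    case/and3P=> _ /eqP cF _ sUF; suff /eqP <- : U == F by [].
    by rewrite eqEcard sUF cF -cF0 eFU leqnn.
  case: d le_d annQ subQ ltQ => [|[|[|//]]] _ annQ subQ ltQ.
  - exists [::]; split=> //; exact: locally_regular_nil F0t sUF0.
  - have [a aQ1 aQ0] := ltQ 0%N isT; exists [:: a]; split=> //.
      by move=> c; rewrite inE => /eqP->; apply: sQp aQ1.
    apply: (locally_regular_seq1 memU F0t sUF0 (sQp _ _ aQ1)) => F Ft sUF.
    apply: onlyU => //; apply: contraNneq aQ0 => ka0.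
    by rewrite -(@kap_in k T _ U) ?ka0 ?rpred0 // eFU.
  have [A [i [r [iK ir tri]]]] := subset_ring_trichotomy k U.
  have UQ0 v : v \notin U -> var k v \in Q 0%N by rewrite eFU; apply: F0Q.
  have [zp|dvr|[a [b [ap bp a0 H]]]] := tri (comap i p).
  - have [a aQ1 aQ0] := ltQ 0%N isT; case/negP: aQ0; rewrite -(kap_in _ UQ0) -ir.
    rewrite (zp (r a)) ?rmorph0 ?rpred0 // mem_comap ir (kap_in_at memU) //.
    exact: sQp aQ1.
  - by have := dvr_height1 ir UQ0 (subQ 0%N isT) (subQ 1%N isT) (ltQ 0%N isT)
      (ltQ 1%N isT) (sQp 2) dvr.
  exists [:: i a; i b]; split=> //.
    by move=> c; rewrite !inE => /orP[] /eqP->.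
  apply: (locally_regular_seq2 memU F0t sUF0 ap bp) => [F Ft sUF|].
    apply: onlyU => //; rewrite -ir iK; apply: contraNneq a0 => ia0.
    by rewrite -[a]iK ia0 rmorph0.
  exact: (polynomial_regular_pair memU Ut iK ir).
have lt_Uj : (#|U| < j)%N.
  by rewrite -cF0 proper_card // properEneq neqFU.
have [c cE] : exists c, (j - #|U|)%N = c.+1.
  by exists (j - #|U|).-1; rewrite prednK // subn_gt0.
pose a := elem_sym U c.+1.
have kap_a F : top_face F -> U \subset F -> kap F a = fm (F :\: U).
  by move=> Ft sUF; apply: kap_elem_sym; rewrite ?cFU.
have ap : a \in p := elem_sym_in memU c.
have a0 F : top_face F -> U \subset F -> kap F a != 0.
  by move=> Ft sUF; rewrite kap_a // face_monomial_neq0.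
have reg2 b : b \in p ->
    (forall G, U \subset G -> #|G|.+1 = j -> kap G b != 0) ->
    exists s : seq S, [/\ (d <= size s)%N, {subset s <= p} & locally_regular p N s].
  move=> bp kap_b; exists [:: a; b]; split=> //.
    by move=> x; rewrite !inE => /orP[] /eqP->.
  apply: (locally_regular_seq2 memU F0t sUF0 ap bp a0) => y y' e.
  exists (fm U); first exact: faceU_notin memU.
  exact: (locally_regular2 kap_a kap_b e).
case: c => [|c] in cE a kap_a ap a0 reg2 *; last first.
  (* Two or more: the variables outside U already give depth two. *)
  apply: (reg2 (outer_sum U)); first exact: outer_sum_in memU.
  move=> G sUG cG; apply: kap_outer_sum_neq0.
  by rewrite -ltnS cG -subn_gt0 subnS cE.
(* One: the variable outside U only gives depth one, and the second element is a
   polynomial in the variables of U, available once p is not the coordinate prime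
   of U. *)
have [le_d1|lt_1d] := leqP d 1.
  exists [:: a]; split=> //; first by move=> x; rewrite inE => /eqP->.
  exact: (locally_regular_seq1 memU F0t sUF0 ap a0).
have d2 : d = 2 by apply/eqP; rewrite eqn_leq le_d.
subst d.
have [w wFU] : exists w, w \in F0 :\: U.
  by apply/set0Pn; rewrite -card_gt0 cFU // cE.
move: (wFU); rewrite inE => /andP[wU wF0].
have eUw : U = F0 :\ w.
  apply/eqP; rewrite eqEcard subsetD1 sUF0 wU -ltnS.
  have -> : #|F0 :\ w|.+1 = j by rewrite -cF0 (cardsD1 w F0) wF0.
  by rewrite -addn1 -leq_subLR cE.
have [f fp kf] := hyperplane_height1 wF0 F0Q (subQ 0%N isT) (subQ 1%N isT)
  (ltQ 0%N isT) (ltQ 1%N isT) (sQp 2).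
apply: (reg2 (kap U f)); first by rewrite (kap_in_at memU).
move=> G sUG _; rewrite kap_kap (setIidPr sUG) eUw.
exact: kf.
Qed.

Lemma layer_krull_dim F0 : top_face F0 -> krull_dim N = j%:Z%:E.
Proof.
move=> F0t; have /and3P[F0D /eqP cF0 _] := F0t.
apply: sup_nat_eq => [|d [Q [annQ subQ ltQ]]]; last first.
  have [F Ft FQ] := annihilator_prime (annQ 0%N ^~ (leq0n d)).
  have /and3P[_ /eqP <- _] := Ft.
  apply: (coordinate_chain_length _ subQ ltQ) => f.
  by rewrite mem_coord_prime -(kap_in _ FQ) => /eqP->; apply: rpred0.
pose s := enum F0; have szs : size s = j by rewrite -cardE.
pose D i := [set v in drop i s].
have sD i : D i \subset F0.
  by apply/subsetP => v; rewrite inE => /mem_drop; rewrite mem_enum.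
have DS i : D i.+1 \subset D i.
  by apply/subsetP => v; rewrite !inE -addn1 addnC -drop_drop => /mem_drop.
exists (fun i => coord_prime k (D i)); split.
- move=> i a _ anna; rewrite mem_coord_prime.
  have [x xE] := layer_monomial (top_face_layer F0t).
  have := congr1 (coord F0) (anna x); rewrite coord0 coordZ // /coord xE kap_face subxx.
  move/eqP; rewrite mulf_eq0 (negPf (face_monomial_neq0 _ _)) orbF => /eqP ka0.
  by rewrite -(kap_kapS _ (sD i)) ka0 rmorph0.
- move=> i _ a; rewrite mem_coord_prime => /eqP a0; rewrite mem_coord_prime.
  by rewrite -(kap_kapS a (DS i)) a0 rmorph0.
move=> i lt_i; have [v0 vs] : exists v0 : T, true.
  by move: lt_i; rewrite -szs; case: (s) => // v0 _; exists v0.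
pose v := nth v0 s i; have dE : drop i s = v :: drop i.+1 s.
  by rewrite (drop_nth v0) // szs.
have vN : v \notin drop i.+1 s.
  by have := drop_uniq i (enum_uniq F0); rewrite -/s dE => /andP[].
exists (var k v); rewrite mem_coord_prime kap_var inE ?(negPf vN) ?eqxx //.
by rewrite dE mem_head -face_monomial1 face_monomial_neq0.
Qed.
End Layer.

(** * The dimension filtration of a face ring *)

Section FacetSizes.
Variables (T : finType) (Delta : {set {set T}}).
Hypothesis Delta_down :
  forall F G : {set T}, F \in Delta -> G \subset F -> G \in Delta.
Implicit Types F G H : {set T}.

Lemma long_face b G : long Delta b G -> G \in Delta.
Proof. by case/longP=> F [FD _]; apply: Delta_down. Qed.

Lemma long_le b b' G : (b <= b')%N -> long Delta b' G -> long Delta b G.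
Proof.
move=> le_b /longP[F [FD cF sGF]]; apply/longP; exists F; split=> //.
exact: leq_trans le_b cF.
Qed.

Definition facet_sizes : seq nat :=
  [seq b <- iota 0 #|T|.+1 | [exists F, top_face Delta b F]].

(** The default exceeds the size of every face, so that the last step of the
filtration is the whole ring. *)
Definition facet_size i : nat := nth #|T|.+1 facet_sizes i.

Lemma facet_sizes_sorted : sorted ltn facet_sizes.
Proof. exact/sorted_filter/iota_ltn_sorted/ltn_trans. Qed.

Lemma facet_size_out i G : (size facet_sizes <= i)%N ->
  long Delta (facet_size i) G = false.
Proof.
move=> le_i; apply/negbTE/longP => -[F [_]].
rewrite /facet_size nth_default // => lt_F _.
by have := max_card (mem F); rewrite leqNgt lt_F.
Qed.

Lemma facet_size_top i : (i < size facet_sizes)%N ->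
  exists F, top_face Delta (facet_size i) F.
Proof.
move=> lt_i; have := mem_nth #|T|.+1 lt_i; rewrite mem_filter => /andP[+ _].
by case/existsP=> F Ft; exists F.
Qed.

Lemma facet_size_lt i l : (i < l < size facet_sizes)%N ->
  (facet_size i < facet_size l)%N.
Proof.
case/andP=> lt_il lt_l; apply: (sorted_ltn_nth ltn_trans _ facet_sizes_sorted) => //.
by rewrite inE (ltn_trans lt_il).
Qed.

Lemma facet_size_le i l : (i <= l < size facet_sizes)%N ->
  (facet_size i <= facet_size l)%N.
Proof.
rewrite leq_eqVlt; case: eqP => [->//|_ /= h].
by rewrite ltnW // facet_size_lt.
Qed.

Lemma face_in_facet G : G \in Delta ->
  exists i F, [/\ (i < size facet_sizes)%N, top_face Delta (facet_size i) F
    & G \subset F].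
Proof.
move=> GD; pose P := [pred F : {set T} | (F \in Delta) && (G \subset F)].
have PG : P G by rewrite /= GD /=.
case: (@arg_maxnP _ G P (fun F => #|F|) PG) => F /andP[FD sGF] maxF.
have Ft : top_face Delta #|F| F.
  rewrite /top_face FD eqxx /=; apply/longP => -[H [HD cH sFH]].
  have /maxF : P H by rewrite /= HD (subset_trans sGF).
  by rewrite /= leqNgt cH.
have Fin : #|F| \in facet_sizes.
  rewrite mem_filter mem_iota /= add0n ltnS max_card andbT.
  by apply/existsP; exists F.
exists (index #|F| facet_sizes), F; rewrite index_mem; split=> //.
by rewrite /facet_size nth_index.
Qed.

Lemma top_face_long b F G : top_face Delta b F -> G \subset F -> long Delta b G.
Proof. by case/and3P=> FD /eqP cF _ sGF; apply/longP; exists F; rewrite cF. Qed.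

Lemma long_facet_size0 G : long Delta (facet_size 0) G = (G \in Delta).
Proof.
apply/idP/idP => [|GD]; first exact: long_face.
have [i [F [lt_i Ft sGF]]] := face_in_facet GD.
apply: long_le (top_face_long Ft sGF).
by rewrite facet_size_le.
Qed.

(** No facet has a size strictly between two consecutive facet sizes. *)
Lemma long_facet_sizeS i G : (i < size facet_sizes)%N ->
  long Delta (facet_size i.+1) G = long Delta (facet_size i).+1 G.
Proof.
move=> lt_i; apply/idP/idP.
  have [lt_i1|le_i1] := ltnP i.+1 (size facet_sizes).
    by apply: long_le; rewrite facet_size_lt // ltnSn.
  by rewrite facet_size_out.
case/longP=> F [FD lt_F sGF]; have [l [H [lt_l Ht sFH]]] := face_in_facet FD.
apply: long_le (top_face_long Ht (subset_trans sGF sFH)).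
apply: facet_size_le; rewrite lt_l andbT ltnNge; apply/negP => le_li.
have /and3P[_ /eqP cH _] := Ht; have := subset_leq_card sFH.
rewrite cH leqNgt => /negP[]; apply: leq_ltn_trans lt_F.
by apply: facet_size_le; rewrite le_li.
Qed.
End FacetSizes.

Section Filtration.
Variables (k : fieldType) (T : finType) (Delta : {set {set T}}).
Hypothesis Delta_down :
  forall F G : {set T}, F \in Delta -> G \subset F -> G \in Delta.
Local Notation S := {mpoly k[#|T|]}.
Local Notation M := (@face_ring k T Delta).
Local Notation I := (@SR_ideal k T Delta).
Implicit Types (f g s : S) (F G H : {set T}).

Lemma part_mul0 (P : pred {set T}) s f :
  (forall G H, G \subset H -> P H -> P G) -> part P f = 0 -> part P (s * f) = 0.
Proof.
move=> Pdown /part_eq0P f0; apply/part_eq0P => m /msupp_mul[m1 [m2 [_ m2f ->]]].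
by apply: contra (f0 _ m2f); apply: Pdown; rewrite suppD subsetUr.
Qed.

Lemma SR_idealP f : (f \in I) <-> part (mem Delta) f = 0.
Proof.
split=> [/asboolP[g ->]|/part_eq0P f0].
  rewrite raddf_sum big1 // => F nF; apply: part_mul0.
    by move=> G H sGH HD; apply: Delta_down HD sGH.
  by apply/part_eq0P => m; rewrite face_monomialE msuppX inE => /eqP->;
     rewrite supp_set_mnm.
have g_ex F : exists g, part (pred1 F) f = face_monomial k F * g.
  apply: face_monomial_dvd => m; rewrite mcoeff_msupp mcoeff_part /=.
  by case: ifP => [/eqP->|_]; rewrite ?eqxx.
have [g gP] := choice g_ex; apply/asboolP; exists g.
under eq_bigr do rewrite mulrC -gP.
apply/mpolyP => m; rewrite raddf_sum /=.
under eq_bigr do rewrite mcoeff_part /= eq_sym.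
have [mf|mNf] := boolP (m \in msupp f); last first.
  by rewrite memN_msupp_eq0 // big1 // => F _; rewrite if_same.
rewrite (bigD1 (supp m)) /=; last exact: f0.
by rewrite eqxx big1 ?addr0 // => F /andP[_ /negPf->].
Qed.

Definition proj_face (f : S) : M := quotmod_proj I (f : S^o).
Definition lift_face (x : M) : S := repr (x : Quotient.quot (submod_pred I)).

Lemma lift_faceK x : proj_face (lift_face x) = x.
Proof. exact: quotmod_projK. Qed.

Lemma proj_faceD f g : proj_face (f + g) = proj_face f + proj_face g.
Proof. exact: quotmod_projD. Qed.

Lemma proj_faceZ s f : proj_face (s * f) = s *: proj_face f.
Proof. by apply/esym; apply: (quotmod_projZ I s (f : S^o)). Qed.

Lemma proj_face_eq f g :
  proj_face f = proj_face g <-> part (mem Delta) (f - g) = 0.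
Proof. by rewrite -SR_idealP; apply: quotmod_projP. Qed.

Lemma proj_face0 : proj_face 0 = 0.
Proof.
by apply: (addrI (proj_face 0)); rewrite -proj_faceD !addr0.
Qed.

Lemma proj_face_eq0 f : (proj_face f == 0) = (part (mem Delta) f == 0).
Proof.
by rewrite -proj_face0; apply/eqP/eqP => [/proj_face_eq|h];
   [|apply/proj_face_eq]; rewrite subr0.
Qed.

(** The largest submodule of dimension less than b: a monomial generates a
submodule whose dimension is the size of a largest face containing its support. *)
Definition dim_lt (b : nat) : {pred M} := fun x =>
  `[< exists2 f, x = proj_face f & part (long Delta b) f = 0 >].

Lemma mem_dim_lt b f : (proj_face f \in dim_lt b) = (part (long Delta b) f == 0).
Proof.
apply/asboolP/eqP => [[g /proj_face_eq e g0]|f0]; last by exists f.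
rewrite -[f](subrK g) raddfD /= g0 addr0; apply/part_eq0P => m mfg.
by move/part_eq0P/(_ m mfg): e; apply: contra; apply: long_face.
Qed.

Lemma dim_lt_closed b : subsemimod_closed (dim_lt b).
Proof.
split=> [|s x]; first split=> [|x y].
- by rewrite -proj_face0 mem_dim_lt raddf0.
- rewrite -(lift_faceK x) -(lift_faceK y) -proj_faceD !mem_dim_lt raddfD /=.
  by move=> /eqP-> /eqP->; rewrite addr0.
rewrite -(lift_faceK x) -proj_faceZ !mem_dim_lt => /eqP x0.
by rewrite part_mul0 //; apply: longS.
Qed.

HB.instance Definition _ b :=
  GRing.isSubmodClosed.Build S M (dim_lt b) (dim_lt_closed b).

Definition dim_filtration b : submodClosed M := dim_lt b.

Lemma mem_dim_filtration b f :
  (proj_face f \in dim_filtration b) = (part (long Delta b) f == 0).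
Proof. exact: mem_dim_lt. Qed.

Lemma dim_filtration_graded b :
  graded_submod (face_ring_piece (Delta := Delta)) (dim_filtration b).
Proof.
move=> x; rewrite -(lift_faceK x); move: (lift_face x) => f.
rewrite mem_dim_filtration => /eqP/part_eq0P f0.
exists [seq proj_face (f@_m *: 'X_[m]) | m <- msupp f]; split.
  move=> y /mapP[m mf ->]; split.
    rewrite mem_dim_filtration; apply/eqP/part_eq0P => m' /msuppZ_le.
    by rewrite msuppX inE => /eqP->; apply: f0.
  exists (Posz (mdeg m)); exists (f@_m *: 'X_[m]) => //.
  by apply: dhomogZ; rewrite dhomogX.
rewrite big_map {1}[f]mpolyE; apply: (big_morph _ proj_faceD proj_face0).
Qed.

Section Piece.
Variables (b b' : nat).
Local Notation L := (dim_filtration b').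
Local Notation L0 := (dim_filtration b).
Local Notation piece := (subquot L L0).

Definition piece_class f (h : proj_face f \in L) : piece :=
  quotmod_proj (submod_trace L L0) (SubMod h).

Lemma pieceP (x : piece) : exists f (h : proj_face f \in L), x = piece_class h.
Proof.
rewrite -[x]quotmod_projK; case: (repr _) => y yL.
by move: (yL); rewrite -(lift_faceK y) => yL'; exists (lift_face y), yL';
   congr quotmod_proj; apply/val_inj; rewrite /= lift_faceK.
Qed.

Definition piece_pred : pred {set T} :=
  fun G => long Delta b G && ~~ long Delta b' G.

Definition piece_coords (x : piece) : S :=
  part piece_pred (lift_face
    (submod_val (repr (x : Quotient.quot (submod_pred (submod_trace L L0)))))).

Lemma part_piece0 f : part (long Delta b) f = 0 -> part piece_pred f = 0.
Proof.
move/part_eq0P=> f0; apply/part_eq0P => m /f0.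
by apply: contra => /andP[].
Qed.

Lemma piece_class_eq f g (hf : proj_face f \in L) (hg : proj_face g \in L) :
  piece_class hf = piece_class hg <-> part (long Delta b) (f - g) = 0.
Proof.
rewrite /piece_class quotmod_projP.
have -> : (SubMod hf - SubMod hg \in submod_trace L L0)
    = (proj_face (f - g) \in L0).
  transitivity (val (SubMod hf - SubMod hg) \in L0); first by [].
  rewrite raddfB /=; have -> // : proj_face f - proj_face g = proj_face (f - g).
  by apply/eqP; rewrite subr_eq -proj_faceD subrK.
by rewrite mem_dim_filtration; split=> /eqP.
Qed.

Lemma piece_coordsE f (h : proj_face f \in L) :
  piece_coords (piece_class h) = part piece_pred f.
Proof.
rewrite /piece_coords; have := quotmod_projK (piece_class h).
case: (repr _) => y yL /= e; apply/eqP; rewrite -subr_eq0 -raddfB /=.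
apply/eqP/part_piece0; move: (yL); rewrite -{1}(lift_faceK y) => yL'.
apply/(piece_class_eq yL' h); rewrite -e; congr quotmod_proj.
by apply/val_inj; rewrite /= lift_faceK.
Qed.

Lemma piece_coordsP : monomial_coords piece_pred piece_coords.
Proof.
have PL f : part (long Delta b') f = 0 -> part piece_pred f = 0 ->
    part (long Delta b) f = 0.
  move=> /part_eq0P f1 /part_eq0P f2; apply/part_eq0P => m mf.
  by apply: contra (f2 m mf) => lm; rewrite /piece_pred lm f1.
split.
- move=> x y; have [f [hf ->]] := pieceP x; have [g [hg ->]] := pieceP y.
  have hfg : proj_face (f - g) \in L.
    move: hf hg; rewrite !mem_dim_filtration => /eqP f0 /eqP g0.
    by rewrite raddfB /= f0 g0 subrr.
  have eD : piece_class hf = piece_class hfg + piece_class hg.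
    rewrite /piece_class -quotmod_projD; congr quotmod_proj; apply/val_inj.
    by rewrite /= -proj_faceD subrK.
  have -> : piece_class hf - piece_class hg = piece_class hfg by rewrite eD addrK.
  by rewrite !piece_coordsE raddfB.
- move=> x y; have [f [hf ->]] := pieceP x; have [g [hg ->]] := pieceP y.
  rewrite !piece_coordsE => e; apply/piece_class_eq; apply: PL.
    move: hf hg; rewrite !mem_dim_filtration => /eqP f0 /eqP g0.
    by rewrite raddfB /= f0 g0 subrr.
  by rewrite raddfB /= e subrr.
- move=> x; have [f [hf ->]] := pieceP x.
  by rewrite piece_coordsE part_part.
- move=> f fP; have hf : proj_face f \in L.
    rewrite mem_dim_filtration; apply/eqP/part_eq0P => m mf.
    by move/part_idP/(_ m mf): fP => /andP[].
  by exists (piece_class hf); rewrite piece_coordsE.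
move=> s x; have [f [hf ->]] := pieceP x.
have hsf : proj_face (s * f) \in L.
  move: hf; rewrite !mem_dim_filtration => /eqP f0.
  by rewrite part_mul0 //; apply: longS.
have -> : s *: piece_class hf = piece_class hsf.
  apply: etrans (quotmod_projZ _ _ _) _; congr quotmod_proj.
  by apply/val_inj; rewrite /= proj_faceZ.
rewrite !piece_coordsE; apply/eqP; rewrite -subr_eq0 -raddfB /= -mulrBr.
apply/eqP/part_piece0/part_mul0; first exact: longS.
apply: PL; last by rewrite raddfB /= part_part subrr.
apply/part_eq0P => m; rewrite mcoeff_msupp mcoeffB mcoeff_part => mf.
move: hf; rewrite mem_dim_filtration => /eqP/part_eq0P; apply.
rewrite mcoeff_msupp; apply: contraNneq mf => ->.
by rewrite if_same subrr.
Qed.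
End Piece.

Hypothesis Delta_conn : exchange_connected Delta.

Lemma piece_layer i : (i < size (facet_sizes Delta))%N ->
  piece_pred (facet_size Delta i) (facet_size Delta i.+1)
    = layer Delta (facet_size Delta i).
Proof.
move=> lt_i; apply: funext => G; rewrite /piece_pred /layer.
by rewrite long_facet_sizeS.
Qed.

Local Notation fs := (facet_size Delta).

Lemma piece_serre i : (i < size (facet_sizes Delta))%N ->
  serre 2 (subquot (dim_filtration (fs i.+1)) (dim_filtration (fs i))).
Proof.
move=> lt_i; have := piece_coordsP (fs i) (fs i.+1); rewrite piece_layer //.
exact: layer_serre.
Qed.

Lemma piece_krull_dim i : (i < size (facet_sizes Delta))%N ->
  krull_dim (subquot (dim_filtration (fs i.+1)) (dim_filtration (fs i)))
    = (fs i)%:Z%:E.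
Proof.
move=> lt_i; have [F Ft] := facet_size_top lt_i.
have := piece_coordsP (fs i) (fs i.+1); rewrite piece_layer // => H.
exact: (layer_krull_dim H Ft).
Qed.

(** The dimension filtration, indexed by the facet sizes so that no step is
trivial. *)
Lemma exchange_connected_seq_serre : complex_seq_serre k Delta 2.
Proof.
exists (size (facet_sizes Delta)), (fun i => dim_filtration (fs i)); split.
- split=> x; rewrite -(lift_faceK x) mem_dim_filtration.
    rewrite proj_face_eq0; congr (_ == _); apply/mpolyP => m.
    by rewrite !mcoeff_part long_facet_size0.
  apply/eqP/part_eq0P => m _.
  by rewrite facet_size_out.
- by move=> i _; apply: dim_filtration_graded.
- move=> i lt_i; split=> [x|].
    rewrite -(lift_faceK x) !mem_dim_filtration => /eqP/part_eq0P f0.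
    apply/eqP/part_eq0P => m /f0; apply: contra; rewrite long_facet_sizeS //.
    exact: long_le.
  have [F Ft] := facet_size_top lt_i; have /andP[lF nlF] := top_face_layer Ft.
  have face0 b : (proj_face (face_monomial k F) \in dim_filtration b)
      = ~~ long Delta b F.
    rewrite mem_dim_filtration; apply/eqP/idP => [/part_eq0P|nl].
      move/(_ (set_mnm F)); rewrite supp_set_mnm; apply.
      by rewrite face_monomialE msuppX mem_head.
    apply/part_eq0P => m; rewrite face_monomialE msuppX inE => /eqP->.
    by rewrite supp_set_mnm.
  exists (proj_face (face_monomial k F)); rewrite face0 ?long_facet_sizeS //.
  by rewrite lF.
- exact: piece_serre.
move=> i lt_i; rewrite !piece_krull_dim //; last exact: ltnW.
by rewrite lte_fin ltz_nat facet_size_lt // ltnSn.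
Qed.
End Filtration.

Theorem theorem4p9 (k : fieldType) (T : finType) (e : rel T)
  (He : simple_graph e)
  (Hcyc : forall c : seq T, graph_cycle e c -> chordless e c ->
     ~~ odd (size c) -> exists2 x, x \in c & has_whisker e x) :
  graph_seq_serre e k 2.
Proof.
apply: exchange_connected_seq_serre => [F G FD sGF|].
  apply/independentP => x y xG yG; move/independentP: FD; apply.
    exact: (subsetP sGF).
  exact: (subsetP sGF).
exact: independence_complex_exchange_connected He Hcyc.
Qed.
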